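(* The category $\mathbf{Bigpd}$ of small bigroupoids and morphisms (pseudofunctors) carries a model structure whose fibrations, cofibrations and weak equivalences are exactly the fibrations, cofibrations and weak equivalences defined below.
   Context: A bigroupoid $\mathcal B$ consists of: a set $\mathcal B_0$ of 0-cells; for each $A,B\in\mathcal B_0$ a groupoid $\mathcal B(A,B)$ whose objects are 1-cells $f:A\to B$ and whose arrows are 2-cells; composition functors $*:\mathcal B(B,C)\times\mathcal B(A,B)\to\mathcal B(A,C)$; identity 1-cells $1_A\in\mathcal B(A,A)$; inversion functors $(-)^*:\mathcal B(A,B)\to\mathcal B(B,A)$; and natural isomorphisms $\mathbf a:(h*g)*f\Rightarrow h*(g*f)$, $\mathbf l:1_B*f\Rightarrow f$, $\mathbf r:f*1_A\Rightarrow f$, $\mathbf e:f^**f\Rightarrow 1_A$, $\mathbf i:1_B\Rightarrow f*f^*$ (for $f:A\to B$), such that (i) Mac Lane's pentagon for $\mathbf a$ commutes; (ii) $(\mathrm{id}*\mathbf l)\circ\mathbf a=\mathbf r*\mathrm{id}:(g*1)*f\to g*f$; (iii) $\mathbf r_f\circ(\mathrm{id}*\mathbf e_f)\circ\mathbf a\circ(\mathbf i_f*\mathrm{id})=\mathbf l_f:1_B*f\to f$. A morphism $(F,\phi):\mathcal A\to\mathcal B$ consists of a function $F:\mathcal A_0\to\mathcal B_0$, functors $F_{A,A'}:\mathcal A(A,A')\to\mathcal B(FA,FA')$ and natural isomorphisms $\phi_{g,f}:Fg*Ff\Rightarrow F(g*f)$, $\phi_A:1_{FA}\Rightarrow F1_A$,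 $\phi_f:(Ff)^*\Rightarrow F(f^* )$ such that: $F\mathbf a\circ\phi\circ(\phi*\mathrm{id})=\phi\circ(\mathrm{id}*\phi)\circ\mathbf a$; $F\mathbf r\circ\phi\circ(\mathrm{id}*\phi_A)=\mathbf r$; $F\mathbf l\circ\phi\circ(\phi_B*\mathrm{id})=\mathbf l$; $F\mathbf e\circ\phi\circ(\phi_f*\mathrm{id})=\phi_A\circ\mathbf e$; $F\mathbf i\circ\phi_B=\phi\circ(\mathrm{id}*\phi_f)\circ\mathbf i$. It is strict if all components of $\phi$ are identities. Composition is $(G,\gamma)\circ(F,\phi)=(GF,G\phi\circ\gamma F)$ (components e.g. $G(\phi_{g,f})\circ\gamma_{Fg,Ff}$). A morphism $F:\mathcal A\to\mathcal B$ is a fibration if (1) for every 0-cell $A'$ of $\mathcal A$ and 1-cell $b:B\to FA'$ there is a 1-cell $a:A\to A'$ with $FA=B$, $Fa=b$, and (2) for every 1-cell $a'$ of $\mathcal A$ and 2-cell $\beta:b\Rightarrow Fa'$ there is a 2-cell $\alpha:a\Rightarrow a'$ with $Fa=b$, $F\alpha=\beta$. It is a cofibration if $F$ is injective on 0-cells and every $F_{A,A'}$ is injective on objects. It is a weak equivalence (biequivalence) if (1) for every 0-cell $B$ of $\mathcal B$ there are a 0-cell $A'$ of $\mathcal A$ and a 1-cell $B\to FA'$, and (2) every $F_{A,A'}$ is an equivalence of categories. A weak factorization system on a category is a pair $(\mathcal L,\mathcal R)$ of classes of morphisms such that every morphism factors as a morphism of $\mathcal L$ followed by one of $\mathcal R$,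 $\mathcal L$ is exactly the class of morphisms with the left lifting property against all of $\mathcal R$, and $\mathcal R$ is exactly the class with the right lifting property against all of $\mathcal L$. A model structure on a category consists of classes $\mathcal F,\mathcal C,\mathcal W$ (fibrations, cofibrations, weak equivalences) such that $\mathcal W$ contains all isomorphisms and satisfies 2-out-of-3, and both $(\mathcal C,\mathcal F\cap\mathcal W)$ and $(\mathcal C\cap\mathcal W,\mathcal F)$ are weak factorization systems. (No limits or colimits are required.) *)

(* Defs.v *)
From Corelib Require Import ssreflect.
Unset Implicit Arguments.

Record BGData : Type := {
  ob : Type;
  hom : ob -> ob -> Type;
  cell : forall A B : ob, hom A B -> hom A B -> Type;
  vc : forall (A B : ob) (f g h : hom A B), cell A B g h -> cell A B f g -> cell A B f h;
  idc : forall (A B : ob) (f : hom A B), cell A B f f;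
  vinv : forall (A B : ob) (f g : hom A B), cell A B f g -> cell A B g f;
  c1 : forall A B C : ob, hom B C -> hom A B -> hom A C;
  hc : forall (A B C : ob) (g g' : hom B C) (f f' : hom A B),
        cell B C g g' -> cell A B f f' -> cell A C (c1 A B C g f) (c1 A B C g' f');
  i1 : forall A : ob, hom A A;
  inv1 : forall A B : ob, hom A B -> hom B A;
  inv2 : forall (A B : ob) (f g : hom A B), cell A B f g -> cell B A (inv1 A B f) (inv1 A B g);
  asc : forall (A B C D : ob) (h : hom C D) (g : hom B C) (f : hom A B),
        cell A D (c1 A B D (c1 B C D h g) f) (c1 A C D h (c1 A B C g f));
  lu : forall (A B : ob) (f : hom A B), cell A B (c1 A B B (i1 B) f) f;
  ru : forall (A B : ob) (f : hom A B), cell A B (c1 A A B f (i1 A)) f;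
  ev : forall (A B : ob) (f : hom A B), cell A A (c1 A B A (inv1 A B f) f) (i1 A);
  coev : forall (A B : ob) (f : hom A B), cell B B (i1 B) (c1 B A B f (inv1 A B f))
}.

Arguments hom {_} _ _.
Arguments cell {_ _ _} _ _.
Arguments vc {_ _ _ _ _ _} _ _.
Arguments idc {_ _ _} _.
Arguments vinv {_ _ _ _ _} _.
Arguments c1 {_ _ _ _} _ _.
Arguments hc {_ _ _ _ _ _ _ _} _ _.
Arguments i1 {_} _.
Arguments inv1 {_ _ _} _.
Arguments inv2 {_ _ _ _ _} _.
Arguments asc {_ _ _ _ _} _ _ _.
Arguments lu {_ _ _} _.
Arguments ru {_ _ _} _.
Arguments ev {_ _ _} _.
Arguments coev {_ _ _} _.

Declare Scope bg_scope.
Delimit Scope bg_scope with bg.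
Open Scope bg_scope.
Notation "g ⊙ f" := (c1 g f) (at level 30, right associativity) : bg_scope.
Notation "y ∘ x" := (vc y x) (at level 40, left associativity) : bg_scope.
Notation "y ⋆ x" := (hc y x) (at level 35, no associativity) : bg_scope.

Record BGLaws (B : BGData) : Prop := {
  vc_assoc : forall (a b : ob B) (f g h k : hom a b) (x : cell h k) (y : cell g h) (z : cell f g),
      x ∘ (y ∘ z) = (x ∘ y) ∘ z;
  vc_idl : forall (a b : ob B) (f g : hom a b) (x : cell f g), idc g ∘ x = x;
  vc_idr : forall (a b : ob B) (f g : hom a b) (x : cell f g), x ∘ idc f = x;
  vc_invl : forall (a b : ob B) (f g : hom a b) (x : cell f g), vinv x ∘ x = idc f;
  vc_invr : forall (a b : ob B) (f g : hom a b) (x : cell f g), x ∘ vinv x = idc g;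
  hc_id : forall (a b c : ob B) (g : hom b c) (f : hom a b), idc g ⋆ idc f = idc (g ⊙ f);
  hc_vc : forall (a b c : ob B) (g g' g'' : hom b c) (f f' f'' : hom a b)
      (y' : cell g' g'') (y : cell g g') (x' : cell f' f'') (x : cell f f'),
      (y' ∘ y) ⋆ (x' ∘ x) = (y' ⋆ x') ∘ (y ⋆ x);
  inv2_id : forall (a b : ob B) (f : hom a b), inv2 (idc f) = idc (inv1 f);
  inv2_vc : forall (a b : ob B) (f g h : hom a b) (y : cell g h) (x : cell f g),
      inv2 (y ∘ x) = inv2 y ∘ inv2 x;
  asc_nat : forall (a b c d : ob B) (h h' : hom c d) (g g' : hom b c) (f f' : hom a b)
      (z : cell h h') (y : cell g g') (x : cell f f'),
      asc h' g' f' ∘ ((z ⋆ y) ⋆ x) = (z ⋆ (y ⋆ x)) ∘ asc h g f;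
  lu_nat : forall (a b : ob B) (f f' : hom a b) (x : cell f f'),
      lu f' ∘ (idc (i1 b) ⋆ x) = x ∘ lu f;
  ru_nat : forall (a b : ob B) (f f' : hom a b) (x : cell f f'),
      ru f' ∘ (x ⋆ idc (i1 a)) = x ∘ ru f;
  ev_nat : forall (a b : ob B) (f f' : hom a b) (x : cell f f'),
      ev f' ∘ (inv2 x ⋆ x) = idc (i1 a) ∘ ev f;
  coev_nat : forall (a b : ob B) (f f' : hom a b) (x : cell f f'),
      coev f' ∘ idc (i1 b) = (x ⋆ inv2 x) ∘ coev f;
  pentagon : forall (a b c d e : ob B) (k : hom d e) (h : hom c d) (g : hom b c) (f : hom a b),
      asc k h (g ⊙ f) ∘ asc (k ⊙ h) g f
      = (idc k ⋆ asc h g f) ∘ asc k (h ⊙ g) f ∘ (asc k h g ⋆ idc f);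
  triangle : forall (a b c : ob B) (g : hom b c) (f : hom a b),
      (idc g ⋆ lu f) ∘ asc g (i1 b) f = ru g ⋆ idc f;
  inverse_coh : forall (a b : ob B) (f : hom a b),
      ru f ∘ (idc f ⋆ ev f) ∘ asc f (inv1 f) f ∘ (coev f ⋆ idc f) = lu f
}.

Record Bigroupoid : Type := {
  bg_data :> BGData;
  bg_laws : BGLaws bg_data
}.

Record MorphData (A B : BGData) : Type := {
  F0 : ob A -> ob B;
  F1 : forall a a' : ob A, hom a a' -> hom (F0 a) (F0 a');
  F2 : forall (a a' : ob A) (f g : hom a a'), cell f g -> cell (F1 a a' f) (F1 a a' g);
  phc : forall (a b c : ob A) (g : hom b c) (f : hom a b),
      cell (F1 b c g ⊙ F1 a b f) (F1 a c (g ⊙ f));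
  ph1 : forall a : ob A, cell (i1 (F0 a)) (F1 a a (i1 a));
  phi : forall (a b : ob A) (f : hom a b), cell (inv1 (F1 a b f)) (F1 b a (inv1 f))
}.

Arguments F0 {_ _} _ _.
Arguments F1 {_ _} _ {_ _} _.
Arguments F2 {_ _} _ {_ _ _ _} _.
Arguments phc {_ _} _ {_ _ _} _ _.
Arguments ph1 {_ _} _ _.
Arguments phi {_ _} _ {_ _} _.

Record MorphLaws (A B : BGData) (F : MorphData A B) : Prop := {
  F2_id : forall (a a' : ob A) (f : hom a a'), F2 F (idc f) = idc (F1 F f);
  F2_vc : forall (a a' : ob A) (f g h : hom a a') (y : cell g h) (x : cell f g),
      F2 F (y ∘ x) = F2 F y ∘ F2 F x;
  phc_nat : forall (a b c : ob A) (g g' : hom b c) (f f' : hom a b) (y : cell g g') (x : cell f f'),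
      F2 F (y ⋆ x) ∘ phc F g f = phc F g' f' ∘ (F2 F y ⋆ F2 F x);
  phi_nat : forall (a b : ob A) (f f' : hom a b) (x : cell f f'),
      F2 F (inv2 x) ∘ phi F f = phi F f' ∘ inv2 (F2 F x);
  M_asc : forall (a b c d : ob A) (h : hom c d) (g : hom b c) (f : hom a b),
      F2 F (asc h g f) ∘ phc F (h ⊙ g) f ∘ (phc F h g ⋆ idc (F1 F f))
      = phc F h (g ⊙ f) ∘ (idc (F1 F h) ⋆ phc F g f) ∘ asc (F1 F h) (F1 F g) (F1 F f);
  M_ru : forall (a b : ob A) (f : hom a b),
      F2 F (ru f) ∘ phc F f (i1 a) ∘ (idc (F1 F f) ⋆ ph1 F a) = ru (F1 F f);
  M_lu : forall (a b : ob A) (f : hom a b),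
      F2 F (lu f) ∘ phc F (i1 b) f ∘ (ph1 F b ⋆ idc (F1 F f)) = lu (F1 F f);
  M_ev : forall (a b : ob A) (f : hom a b),
      F2 F (ev f) ∘ phc F (inv1 f) f ∘ (phi F f ⋆ idc (F1 F f)) = ph1 F a ∘ ev (F1 F f);
  M_coev : forall (a b : ob A) (f : hom a b),
      F2 F (coev f) ∘ ph1 F b = phc F f (inv1 f) ∘ (idc (F1 F f) ⋆ phi F f) ∘ coev (F1 F f)
}.

Arguments MorphLaws {_ _} _.

Record Morph (A B : Bigroupoid) : Type := {
  m_data :> MorphData A B;
  m_laws : MorphLaws m_data
}.

Section Comp.
Variables (A B C : BGData) (LA : BGLaws A) (LB : BGLaws B) (LC : BGLaws C).
Variables (F : MorphData A B) (G : MorphData B C) (LF : MorphLaws F) (LG : MorphLaws G).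

Definition comp_data : MorphData A C := {|
  F0 := fun a => F0 G (F0 F a);
  F1 := fun a a' f => F1 G (F1 F f);
  F2 := fun a a' f g x => F2 G (F2 F x);
  phc := fun a b c g f => F2 G (phc F g f) ∘ phc G (F1 F g) (F1 F f);
  ph1 := fun a => F2 G (ph1 F a) ∘ ph1 G (F0 F a);
  phi := fun a b f => F2 G (phi F f) ∘ phi G (F1 F f) |}.



Lemma comp_laws : MorphLaws comp_data.
Proof.
  destruct LC as [aC idlC idrC _ _ hcidC hcvcC i2idC i2vcC ascnC lunC runC evnC coevnC _ _ _].
  destruct LF as [F2id F2vc phcn phin Fasc Fru Flu Fev Fcoev].
  destruct LG as [G2id G2vc Gphcn Gphin Gasc Gru Glu Gev Gcoev].
  have lt2 : forall (a b : ob C) (f g k : hom a b) (x : cell g k) (y : cell f g) (r : cell f k),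
      x ∘ y = r -> forall (l : hom a b) (P : cell k l), P ∘ x ∘ y = P ∘ r.
  { by move=> ? ? ? ? ? ? ? ? H ? ?; rewrite -H !aC. }
  have lt3 : forall (a b : ob C) (e f g k : hom a b) (x : cell g k) (y : cell f g) (z : cell e f) (r : cell e k),
      x ∘ y ∘ z = r -> forall (l : hom a b) (P : cell k l), P ∘ x ∘ y ∘ z = P ∘ r.
  { by move=> ? ? ? ? ? ? ? ? ? ? H ? ?; rewrite -H !aC. }
  have hcl : forall (a b c : ob C) (g g' g'' : hom b c) (f : hom a b) (y' : cell g' g'') (y : cell g g'),
      (y' ∘ y) ⋆ idc f = (y' ⋆ idc f) ∘ (y ⋆ idc f).
  { by move=> *; rewrite -hcvcC idlC. }
  have hcr : forall (a b c : ob C) (g : hom b c) (f f' f'' : hom a b) (x' : cell f' f'') (x : cell f f'),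
      idc g ⋆ (x' ∘ x) = (idc g ⋆ x') ∘ (idc g ⋆ x).
  { by move=> *; rewrite -hcvcC idlC. }
  split; cbn; intros.
  - by rewrite F2id G2id.
  - by rewrite F2vc G2vc.
  - by rewrite aC -G2vc phcn G2vc -!aC Gphcn.
  - by rewrite aC -G2vc phin G2vc -!aC Gphin.
  -
    rewrite hcl -(G2id _ _ (F1 F f)) !aC.
    rewrite (lt2 _ _ _ _ _ _ _ _ (eq_sym (Gphcn _ _ _ _ _ _ _ _ _))).
    rewrite ?aC. rewrite -!G2vc Fasc !G2vc G2id.
    rewrite (lt3 _ _ _ _ _ _ _ _ _ _ (Gasc _ _ _ _ _ _ _)).
    rewrite ?aC hcr ?aC.
    rewrite (lt2 _ _ _ _ _ _ _ _ (Gphcn _ _ _ _ _ _ _ _ _)).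
    by rewrite G2id ?aC.
  - rewrite hcr -(G2id _ _ (F1 F f)) ?aC.
    rewrite (lt2 _ _ _ _ _ _ _ _ (eq_sym (Gphcn _ _ _ _ _ _ _ _ _))).
    by rewrite ?aC -!G2vc Fru G2id Gru.
  - rewrite hcl -(G2id _ _ (F1 F f)) ?aC.
    rewrite (lt2 _ _ _ _ _ _ _ _ (eq_sym (Gphcn _ _ _ _ _ _ _ _ _))).
    by rewrite ?aC -!G2vc Flu G2id Glu.
  - rewrite hcl -(G2id _ _ (F1 F f)) ?aC.
    rewrite (lt2 _ _ _ _ _ _ _ _ (eq_sym (Gphcn _ _ _ _ _ _ _ _ _))).
    rewrite ?aC -!G2vc Fev !G2vc G2id.
    by rewrite (lt3 _ _ _ _ _ _ _ _ _ _ (Gev _ _ _)) ?aC.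
  - rewrite ?aC -G2vc Fcoev !G2vc.
    rewrite (lt2 _ _ _ _ _ _ _ _ (Gcoev _ _ _)) ?aC.
    rewrite (lt2 _ _ _ _ _ _ _ _ (Gphcn _ _ _ _ _ _ _ _ _)).
    by rewrite G2id hcr ?aC.
Qed.
End Comp.

Section Ident.
Variables (A : BGData) (LA : BGLaws A).
Definition id_data : MorphData A A := {|
  F0 := fun a => a;
  F1 := fun a a' f => f;
  F2 := fun a a' f g x => x;
  phc := fun a b c g f => idc (g ⊙ f);
  ph1 := fun a => idc (i1 a);
  phi := fun a b f => idc (inv1 f) |}.

Lemma id_laws : MorphLaws id_data.
Proof.
  destruct LA as [aA idl idr _ _ hcid hcvc i2id i2vc _ _ _ _ _ _ _ _].
  split; cbn; intros; rewrite ?hcid ?i2id ?idl ?idr //.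
Qed.
End Ident.

Definition idM (A : Bigroupoid) : Morph A A :=
  {| m_data := id_data A; m_laws := id_laws A (bg_laws A) |}.

Definition compM (A B C : Bigroupoid) (G : Morph B C) (F : Morph A B) : Morph A C :=
  {| m_data := comp_data A B C F G;
     m_laws := comp_laws A B C (bg_laws C) F G (m_laws A B F) (m_laws B C G) |}.

(* Model structures on a category (no limits/colimits required)         *)

Record CatData : Type := {
  Obj : Type;
  Hom : Obj -> Obj -> Type;
  cid : forall X : Obj, Hom X X;
  ccomp : forall X Y Z : Obj, Hom Y Z -> Hom X Y -> Hom X Z
}.
Arguments Hom {_} _ _.
Arguments cid {_} _.
Arguments ccomp {_ _ _ _} _ _.

Definition MorClass (C : CatData) : Type := forall X Y : Obj C, Hom X Y -> Prop.

Definition cap_class (C : CatData) (K L : MorClass C) : MorClass C :=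
  fun X Y f => K X Y f /\ L X Y f.

Definition is_iso (C : CatData) (X Y : Obj C) (f : Hom X Y) : Prop :=
  exists g : Hom Y X, ccomp g f = cid X /\ ccomp f g = cid Y.

Definition lifts (C : CatData) (A B X Y : Obj C) (i : Hom A B) (p : Hom X Y) : Prop :=
  forall (u : Hom A X) (v : Hom B Y), ccomp p u = ccomp v i ->
    exists h : Hom B X, ccomp h i = u /\ ccomp p h = v.

Definition is_WFS (C : CatData) (L R : MorClass C) : Prop :=
  (forall (X Y : Obj C) (f : Hom X Y),
     exists (Z : Obj C) (i : Hom X Z) (p : Hom Z Y), L X Z i /\ R Z Y p /\ ccomp p i = f)
  /\ (forall (A B : Obj C) (i : Hom A B),
        L A B i <-> (forall (X Y : Obj C) (p : Hom X Y), R X Y p -> lifts C A B X Y i p))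
  /\ (forall (X Y : Obj C) (p : Hom X Y),
        R X Y p <-> (forall (A B : Obj C) (i : Hom A B), L A B i -> lifts C A B X Y i p)).

Definition two_out_of_three (C : CatData) (W : MorClass C) : Prop :=
  forall (X Y Z : Obj C) (f : Hom X Y) (g : Hom Y Z),
    (W X Y f -> W Y Z g -> W X Z (ccomp g f)) /\
    (W X Y f -> W X Z (ccomp g f) -> W Y Z g) /\
    (W Y Z g -> W X Z (ccomp g f) -> W X Y f).

Definition is_model_structure (C : CatData) (Fib Cof We : MorClass C) : Prop :=
  (forall (X Y : Obj C) (f : Hom X Y), is_iso C X Y f -> We X Y f)
  /\ two_out_of_three C We
  /\ is_WFS C Cof (cap_class C Fib We)
  /\ is_WFS C (cap_class C Cof We) Fib.

Definition Bigpd : CatData :=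
  {| Obj := Bigroupoid; Hom := Morph; cid := idM; ccomp := compM |}.

Definition injective_fun (X Y : Type) (h : X -> Y) : Prop :=
  forall x y : X, h x = h y -> x = y.

Definition fibration (A B : Bigroupoid) (F : Morph A B) : Prop :=
  (forall (a' : ob A) (b0 : ob B) (b : hom b0 (F0 F a')),
     exists (a0 : ob A) (a : hom a0 a'),
       existT (fun x : ob B => hom x (F0 F a')) (F0 F a0) (F1 F a)
       = existT (fun x : ob B => hom x (F0 F a')) b0 b)
  /\
  (forall (a0 a1 : ob A) (a' : hom a0 a1) (b : hom (F0 F a0) (F0 F a1))
          (beta : cell b (F1 F a')),
     exists (a : hom a0 a1) (alpha : cell a a'),
       existT (fun x : hom (F0 F a0) (F0 F a1) => cell x (F1 F a')) (F1 F a) (F2 F alpha)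
       = existT (fun x : hom (F0 F a0) (F0 F a1) => cell x (F1 F a')) b beta).

Definition cofibration (A B : Bigroupoid) (F : Morph A B) : Prop :=
  injective_fun (ob A) (ob B) (F0 F)
  /\ (forall a a' : ob A, injective_fun (hom a a') (hom (F0 F a) (F0 F a')) (@F1 _ _ F a a')).

(* The functor F_{a,a'} : A(a,a') -> B(Fa,Fa') (on objects F1, on arrows F2)
   is an equivalence of categories: it has a quasi-inverse functor G together
   with natural isomorphisms  eta : Id => G F_{a,a'}  and  eps : F_{a,a'} G => Id
   (natural transformations between groupoids are automatically isomorphisms). *)
Definition hom_functor_equivalence (A B : Bigroupoid) (F : Morph A B) (a a' : ob A) : Prop :=
  exists (G1 : hom (F0 F a) (F0 F a') -> hom a a')
         (G2 : forall g g' : hom (F0 F a) (F0 F a'), cell g g' -> cell (G1 g) (G1 g'))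
         (eta : forall f : hom a a', cell f (G1 (F1 F f)))
         (eps : forall g : hom (F0 F a) (F0 F a'), cell (F1 F (G1 g)) g),
    (forall g, G2 g g (idc g) = idc (G1 g))
    /\ (forall g g' g'' (y : cell g' g'') (x : cell g g'), G2 g g'' (y ∘ x) = G2 g' g'' y ∘ G2 g g' x)
    /\ (forall (f f' : hom a a') (x : cell f f'), eta f' ∘ x = G2 _ _ (F2 F x) ∘ eta f)
    /\ (forall g g' (y : cell g g'), eps g' ∘ F2 F (G2 g g' y) = y ∘ eps g).

Definition weak_equivalence (A B : Bigroupoid) (F : Morph A B) : Prop :=
  (forall b0 : ob B, exists a' : ob A, inhabited (hom b0 (F0 F a')))
  /\ (forall a a' : ob A, hom_functor_equivalence A B F a a').

(* Main.v *)
From Corelib Require Import ssreflect.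
From Stdlib Require Import ClassicalEpsilon FunctionalExtensionality Eqdep.
Require Import Defs.

(** A 1-cell acts on 2-cells by whiskering bijectively, so the unit and inverse constraints of a morphism are
    determined by, and can be rebuilt from, its compatibility with composition alone ([complete], [morph_eq]).

    A fibration is a weak equivalence iff it is surjective on 0-cells, surjective on 1-cells and locally fully
    faithful; such maps lift against cofibrations by choosing images of the new 0- and 1-cells, everything else
    being forced. Any [F : A -> B] factors as a cofibration followed by such a map through [cyl F], which is [A]
    and [B] put together, with all 2-cells taken from [B].

    For the other factorization let [mp F] have the 0-cells [(a, b, e : b -> F a)], the squares over 1-cells of [A]
    as 1-cells, and the 2-cells of [A] as 2-cells. Then [F] is [mp_unit F : A -> mp F] followed by the fibration
    [mp_src F : mp F -> B]. The canonical edges from [(a, b, e)] to [mp_unit F a] form a contraction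
    [mp F -> mp (mp_unit F)], and for a fibration [p] and [u : A -> X] the map [mp u -> mp (p • u)] is a trivial
    fibration; lifting the cofibration [mp_unit F] against it shows that [mp_unit F] lifts against [p]. All other
    trivial cofibrations are retracts of such units. *)

Set Implicit Arguments.
Unset Strict Implicit.

(** * Algebra of 2-cells *)

Notation "f ◁ x" := (hc (idc f) x) (at level 35, no associativity) : bg_scope.
Notation "x ▷ f" := (hc x (idc f)) (at level 35, no associativity) : bg_scope.

Section Algebra.
Context {B : Bigroupoid}.
Implicit Types a b c d e : ob B.

Lemma vcA a b (f g h k : hom a b) (x : cell h k) (y : cell g h) (z : cell f g) :
  x ∘ y ∘ z = x ∘ (y ∘ z).
Proof. by rewrite (vc_assoc _ (bg_laws B)). Qed.

Lemma vc1l a b (f g : hom a b) (x : cell f g) : idc g ∘ x = x.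
Proof. exact: (vc_idl _ (bg_laws B)). Qed.

Lemma vc1r a b (f g : hom a b) (x : cell f g) : x ∘ idc f = x.
Proof. exact: (vc_idr _ (bg_laws B)). Qed.

Lemma vcVl a b (f g : hom a b) (x : cell f g) : vinv x ∘ x = idc f.
Proof. exact: (vc_invl _ (bg_laws B)). Qed.

Lemma vcVr a b (f g : hom a b) (x : cell f g) : x ∘ vinv x = idc g.
Proof. exact: (vc_invr _ (bg_laws B)). Qed.

(* For rewriting inside right-nested composites. *)
Lemma pre2 a b (f g h k : hom a b) (x : cell g h) (y : cell f g) (r : cell f h) :
  x ∘ y = r -> forall z : cell k f, x ∘ (y ∘ z) = r ∘ z.
Proof. by move=> <- z; rewrite vcA. Qed.

Lemma pre3 a b (f g h k l : hom a b) (x : cell h l) (y : cell g h) (z : cell f g) (r : cell f l) :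
  x ∘ (y ∘ z) = r -> forall w : cell k f, x ∘ (y ∘ (z ∘ w)) = r ∘ w.
Proof. by move=> <- w; rewrite !vcA. Qed.

Lemma vcKl a b (f g h : hom a b) (x : cell g h) (y : cell f g) : vinv x ∘ (x ∘ y) = y.
Proof. by rewrite -vcA vcVl vc1l. Qed.

Lemma vcKr a b (f g h : hom a b) (x : cell h g) (y : cell f g) : x ∘ (vinv x ∘ y) = y.
Proof. by rewrite -vcA vcVr vc1l. Qed.

Lemma vc_canl a b (f g h : hom a b) (x : cell g h) (y z : cell f g) : x ∘ y = x ∘ z -> y = z.
Proof. by move=> E; rewrite -(vcKl x y) E vcKl. Qed.

Lemma vc_canr a b (f g h : hom a b) (x : cell f g) (y z : cell g h) : y ∘ x = z ∘ x -> y = z.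
Proof. by move=> E; rewrite -(vc1r y) -(vc1r z) -(vcVr x) -!vcA E. Qed.

Lemma vinv1 a b (f : hom a b) : vinv (idc f) = idc f.
Proof. by rewrite -{2}(vcVl (idc f)) vc1r. Qed.

Lemma vinv_vc a b (f g h : hom a b) (x : cell g h) (y : cell f g) :
  vinv (x ∘ y) = vinv y ∘ vinv x.
Proof. by apply: (vc_canr (x := x ∘ y)); rewrite vcVl vcA vcKl vcVl. Qed.

Lemma hc11 a b c (g : hom b c) (f : hom a b) : g ◁ idc f = idc (g ⊙ f).
Proof. exact: (hc_id _ (bg_laws B)). Qed.

Lemma hcM a b c (g g' g'' : hom b c) (f f' f'' : hom a b)
    (y' : cell g' g'') (y : cell g g') (x' : cell f' f'') (x : cell f f') :
  (y' ∘ y) ⋆ (x' ∘ x) = (y' ⋆ x') ∘ (y ⋆ x).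
Proof. exact: (hc_vc _ (bg_laws B)). Qed.

Lemma lwM a b c (g : hom b c) (f f' f'' : hom a b) (x' : cell f' f'') (x : cell f f') :
  g ◁ (x' ∘ x) = (g ◁ x') ∘ (g ◁ x).
Proof. by rewrite -hcM vc1l. Qed.

Lemma rwM a b c (g g' g'' : hom b c) (f : hom a b) (y' : cell g' g'') (y : cell g g') :
  (y' ∘ y) ▷ f = (y' ▷ f) ∘ (y ▷ f).
Proof. by rewrite -hcM vc1l. Qed.

Lemma lwV a b c (g : hom b c) (f f' : hom a b) (x : cell f f') :
  g ◁ vinv x = vinv (g ◁ x).
Proof. by apply: (vc_canr (x := g ◁ x)); rewrite -lwM !vcVl hc11. Qed.

Lemma rwV a b c (g g' : hom b c) (f : hom a b) (y : cell g g') :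
  vinv y ▷ f = vinv (y ▷ f).
Proof. by apply: (vc_canr (x := y ▷ f)); rewrite -rwM !vcVl hc11. Qed.

Lemma hcE a b c (g g' : hom b c) (f f' : hom a b) (y : cell g g') (x : cell f f') :
  y ⋆ x = (y ▷ f') ∘ (g ◁ x).
Proof. by rewrite -hcM vc1l vc1r. Qed.

Lemma hcE' a b c (g g' : hom b c) (f f' : hom a b) (y : cell g g') (x : cell f f') :
  y ⋆ x = (g' ◁ x) ∘ (y ▷ f).
Proof. by rewrite -hcM vc1l vc1r. Qed.

Lemma exch a b c (g g' : hom b c) (f f' : hom a b) (y : cell g g') (x : cell f f') :
  (y ▷ f') ∘ (g ◁ x) = (g' ◁ x) ∘ (y ▷ f).
Proof. by rewrite -hcE hcE'. Qed.

Lemma asc_n a b c d (h h' : hom c d) (g g' : hom b c) (f f' : hom a b)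
    (z : cell h h') (y : cell g g') (x : cell f f') :
  asc h' g' f' ∘ ((z ⋆ y) ⋆ x) = (z ⋆ (y ⋆ x)) ∘ asc h g f.
Proof. exact: (asc_nat _ (bg_laws B)). Qed.

Lemma ascl a b c d (h h' : hom c d) (g : hom b c) (f : hom a b) (z : cell h h') :
  asc h' g f ∘ ((z ▷ g) ▷ f) = (z ▷ (g ⊙ f)) ∘ asc h g f.
Proof. by rewrite asc_n hc11. Qed.

Lemma ascm a b c d (h : hom c d) (g g' : hom b c) (f : hom a b) (y : cell g g') :
  asc h g' f ∘ ((h ◁ y) ▷ f) = (h ◁ (y ▷ f)) ∘ asc h g f.
Proof. exact: asc_n. Qed.

Lemma ascr a b c d (h : hom c d) (g : hom b c) (f f' : hom a b) (x : cell f f') :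
  asc h g f' ∘ ((h ⊙ g) ◁ x) = (h ◁ (g ◁ x)) ∘ asc h g f.
Proof. by rewrite -hc11 asc_n. Qed.

(** Turns the naturality square of a constraint into that of its inverse. *)
Lemma vconj a b (p q r s : hom a b) (A : cell q s) (X : cell p q) (Y : cell r s) (A' : cell p r) :
  A ∘ X = Y ∘ A' -> vinv A ∘ Y = X ∘ vinv A'.
Proof. by move=> E; apply: (vc_canr (x := A')); rewrite !vcA -E vcVl vcKl vc1r. Qed.

Lemma luN a b (f f' : hom a b) (x : cell f f') : lu f' ∘ (i1 b ◁ x) = x ∘ lu f.
Proof. exact: (lu_nat _ (bg_laws B)). Qed.

Lemma ruN a b (f f' : hom a b) (x : cell f f') : ru f' ∘ (x ▷ i1 a) = x ∘ ru f.
Proof. exact: (ru_nat _ (bg_laws B)). Qed.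

Lemma pent a b c d e (k : hom d e) (h : hom c d) (g : hom b c) (f : hom a b) :
  (k ◁ asc h g f) ∘ (asc k (h ⊙ g) f ∘ (asc k h g ▷ f)) = asc k h (g ⊙ f) ∘ asc (k ⊙ h) g f.
Proof. by rewrite (pentagon _ (bg_laws B)) !vcA. Qed.

Lemma tri a b c (g : hom b c) (f : hom a b) :
  (g ◁ lu f) ∘ asc g (i1 b) f = ru g ▷ f.
Proof. exact: (triangle _ (bg_laws B)). Qed.

Lemma inv_coh a b (f : hom a b) :
  ru f ∘ ((f ◁ ev f) ∘ (asc f (inv1 f) f ∘ (coev f ▷ f))) = lu f.
Proof. by rewrite -(inverse_coh _ (bg_laws B)) !vcA. Qed.

(** * Whiskering by a 1-cell is bijective on 2-cells *)

Definition lcancel b c (f : hom b c) a (g : hom a b) : cell (inv1 f ⊙ (f ⊙ g)) g :=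
  lu g ∘ ((ev f ▷ g) ∘ vinv (asc (inv1 f) f g)).

Lemma lcancelN a b c (f : hom b c) (g g' : hom a b) (x : cell g g') :
  lcancel f g' ∘ (inv1 f ◁ (f ◁ x)) = x ∘ lcancel f g.
Proof.
  rewrite /lcancel !vcA.
  rewrite (vconj (ascr (inv1 f) f x)) (pre2 (exch (ev f) x)) vcA.
  by rewrite (pre2 (luN x)) vcA.
Qed.

(** By naturality of [lcancel], a 2-cell [x] is conjugate to [inv1 f ◁ (f ◁ x)], so [f ◁ x]
    determines it. *)
Lemma lw_inj a b c (f : hom b c) (g g' : hom a b) (x y : cell g g') :
  f ◁ x = f ◁ y -> x = y.
Proof.
  move=> E; apply: (vc_canr (x := lcancel f g)).
  by rewrite -!lcancelN E.
Qed.

(** The preimage is [inv1 f ◁ y] conjugated by [lcancel]; injectivity of whiskering by [inv1 f]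
    shows that it is one. *)
Lemma lw_full a b c (f : hom b c) (g g' : hom a b) (y : cell (f ⊙ g) (f ⊙ g')) :
  {x : cell g g' | f ◁ x = y}.
Proof.
  exists (lcancel f g' ∘ ((inv1 f ◁ y) ∘ vinv (lcancel f g))).
  apply: (lw_inj (f := inv1 f)).
  apply: (vc_canl (x := lcancel f g')).
  by rewrite lcancelN !vcA vcVl vc1r.
Qed.

Definition lfill a b c (f : hom b c) (g g' : hom a b) (y : cell (f ⊙ g) (f ⊙ g')) : cell g g' :=
  proj1_sig (lw_full y).

Lemma lfillK a b c (f : hom b c) (g g' : hom a b) (y : cell (f ⊙ g) (f ⊙ g')) :
  f ◁ lfill y = y.
Proof. exact: proj2_sig (lw_full y). Qed.

(** Mirror image of [lcancel], with the inverse of [coev] in the place of [ev]. *)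
Definition rcancel a b (f : hom a b) c (g : hom b c) : cell ((g ⊙ f) ⊙ inv1 f) g :=
  ru g ∘ (vinv (g ◁ coev f) ∘ asc g f (inv1 f)).

Lemma rcancelN a b c (f : hom a b) (g g' : hom b c) (x : cell g g') :
  rcancel f g' ∘ ((x ▷ f) ▷ inv1 f) = x ∘ rcancel f g.
Proof.
  rewrite /rcancel !vcA ascl.
  rewrite (pre2 (vconj (eq_sym (exch x (coev f))))) vcA.
  by rewrite (pre2 (ruN x)) vcA.
Qed.

Lemma rw_inj a b c (f : hom a b) (g g' : hom b c) (x y : cell g g') :
  x ▷ f = y ▷ f -> x = y.
Proof.
  move=> E; apply: (vc_canr (x := rcancel f g)).
  by rewrite -!rcancelN E.
Qed.

Lemma rw_full a b c (f : hom a b) (g g' : hom b c) (y : cell (g ⊙ f) (g' ⊙ f)) :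
  {x : cell g g' | x ▷ f = y}.
Proof.
  exists (rcancel f g' ∘ ((y ▷ inv1 f) ∘ vinv (rcancel f g))).
  apply: (rw_inj (f := inv1 f)).
  apply: (vc_canl (x := rcancel f g')).
  by rewrite rcancelN !vcA vcVl vc1r.
Qed.

Definition rfill a b c (f : hom a b) (g g' : hom b c) (y : cell (g ⊙ f) (g' ⊙ f)) : cell g g' :=
  proj1_sig (rw_full y).

Lemma rfillK a b c (f : hom a b) (g g' : hom b c) (y : cell (g ⊙ f) (g' ⊙ f)) :
  rfill y ▷ f = y.
Proof. exact: proj2_sig (rw_full y). Qed.

(* Kelly: these two unit coherences follow from the pentagon and the triangle. *)
Lemma ru_c1 a b c (g : hom b c) (f : hom a b) :
  (g ◁ ru f) ∘ asc g f (i1 a) = ru (g ⊙ f).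
Proof.
  apply: (rw_inj (f := i1 a)); rewrite rwM.
  apply: (vc_canl (x := asc g f (i1 a))).
  rewrite (pre2 (ascm _ _ _)) vcA -!tri lwM vcA pent.
  by rewrite (pre2 (ascr _ _ _)) vcA.
Qed.

Lemma lu_c1 a b c (g : hom b c) (f : hom a b) :
  lu (g ⊙ f) ∘ asc (i1 c) g f = lu g ▷ f.
Proof.
  apply: (lw_inj (f := i1 c)); rewrite lwM.
  apply: (vc_canr (x := asc (i1 c) (i1 c ⊙ g) f ∘ (asc (i1 c) (i1 c) g ▷ f))).
  rewrite !vcA pent (pre2 (tri _ _)) (pre2 (eq_sym (ascm _ _ _))) vcA -rwM tri.
  by rewrite ascl.
Qed.

(** Naturality of [lu] along [lu (i1 a)] identifies [i1 a ◁ lu (i1 a)] with [lu (i1 a ⊙ i1 a)]; the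
    triangle and [lu_c1] then compare the two sides. *)
Lemma lu_ru_i1 a : lu (i1 a) = ru (i1 a).
Proof.
  apply: (rw_inj (f := i1 a)).
  rewrite -tri -lu_c1; congr (_ ∘ _).
  by apply: (vc_canl (x := lu (i1 a))); rewrite luN.
Qed.

End Algebra.

(** * Pasting of squares *)

Section Paste.
Context {B : Bigroupoid}.

(** Two squares glued along [e2]; locked, so that rewriting treats the result as atomic. *)
Definition paste (u1 u2 u3 v1 v2 v3 : ob B) (h1 : hom u1 u2) (h2 : hom u2 u3)
    (g1 : hom v1 v2) (g2 : hom v2 v3) (e1 : hom v1 u1) (e2 : hom v2 u2) (e3 : hom v3 u3)
    (t2 : cell (h2 ⊙ e2) (e3 ⊙ g2)) (t1 : cell (h1 ⊙ e1) (e2 ⊙ g1)) :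
    cell ((h2 ⊙ h1) ⊙ e1) (e3 ⊙ (g2 ⊙ g1)) :=
  locked (asc e3 g2 g1 ∘ ((t2 ▷ g1) ∘ (vinv (asc h2 e2 g1) ∘ ((h2 ◁ t1) ∘ asc h2 h1 e1)))).

(** Makes pairs of 2-cells compatible with squares closed under horizontal composition, as
    [mp_src2_hc] requires. *)
Lemma paste_nat (u1 u2 u3 v1 v2 v3 : ob B) (h1 h1' : hom u1 u2) (h2 h2' : hom u2 u3)
    (g1 g1' : hom v1 v2) (g2 g2' : hom v2 v3) (e1 : hom v1 u1) (e2 : hom v2 u2) (e3 : hom v3 u3)
    (t2 : cell (h2 ⊙ e2) (e3 ⊙ g2)) (t1 : cell (h1 ⊙ e1) (e2 ⊙ g1))
    (t2' : cell (h2' ⊙ e2) (e3 ⊙ g2')) (t1' : cell (h1' ⊙ e1) (e2 ⊙ g1'))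
    (x2 : cell h2 h2') (x1 : cell h1 h1') (y2 : cell g2 g2') (y1 : cell g1 g1') :
  t2' ∘ (x2 ▷ e2) = (e3 ◁ y2) ∘ t2 -> t1' ∘ (x1 ▷ e1) = (e2 ◁ y1) ∘ t1 ->
  paste t2' t1' ∘ ((x2 ⋆ x1) ▷ e1) = (e3 ◁ (y2 ⋆ y1)) ∘ paste t2 t1.
Proof.
  move=> E2 E1; rewrite /paste -!lock !vcA asc_n (hcE' x2 (x1 ▷ e1)) !vcA.
  rewrite (pre2 (eq_sym (lwM _ _ _))) E1 lwM !vcA.
  rewrite (pre2 (vconj (ascr _ _ y1))) vcA (pre2 (exch t2' y1)) vcA.
  rewrite (pre2 (eq_sym (exch x2 t1))) vcA (pre2 (vconj (ascl _ _ x2))) vcA.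
  rewrite (pre2 (eq_sym (rwM _ _ _))) E2 rwM !vcA.
  rewrite (pre2 (ascr _ _ y1)) vcA (pre2 (ascm _ _ _)) vcA.
  by rewrite (pre2 (eq_sym (lwM _ _ _))) -hcE'.
Qed.

(** One pentagon is used for each of the four paths [h3 h2 h1 e1], [h3 h2 e2 g1], [h3 e3 g2 g1] and
    [e4 g3 g2 g1] through the strip of squares. *)
Lemma paste_asc (u1 u2 u3 u4 v1 v2 v3 v4 : ob B)
    (h1 : hom u1 u2) (h2 : hom u2 u3) (h3 : hom u3 u4)
    (g1 : hom v1 v2) (g2 : hom v2 v3) (g3 : hom v3 v4)
    (e1 : hom v1 u1) (e2 : hom v2 u2) (e3 : hom v3 u3) (e4 : hom v4 u4)
    (t3 : cell (h3 ⊙ e3) (e4 ⊙ g3)) (t2 : cell (h2 ⊙ e2) (e3 ⊙ g2)) (t1 : cell (h1 ⊙ e1) (e2 ⊙ g1)) :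
  paste t3 (paste t2 t1) ∘ (asc h3 h2 h1 ▷ e1)
  = (e4 ◁ asc g3 g2 g1) ∘ paste (paste t3 t2) t1.
Proof.
  rewrite /paste -!lock !lwM !rwM !vcA pent.
  rewrite (pre2 (eq_sym (ascr _ _ t1))) vcA.
  rewrite (pre3 (pent _ _ _ _)) vcA (pre2 (ascl _ _ t3)) vcA.
  congr (_ ∘ (_ ∘ _)).
  apply: (vc_canl (x := asc h3 e3 (g2 ⊙ g1))); rewrite vcKr.
  rewrite (pre2 (eq_sym (pent _ _ _ _))) !vcA rwV vcKr.
  rewrite (pre2 (ascm _ _ _)) vcA; congr (_ ∘ (_ ∘ _)).
  apply: (vc_canl (x := h3 ◁ asc h2 e2 g1)); rewrite lwV vcKr.
  by rewrite (pre3 (pent _ _ _ _)) vcA vcKr.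
Qed.

(** The canonical square on [k] with identity edges; the squares of [mp_unit] and [mp_contr] come
    from it. *)
Definition ucell (a b : ob B) (k : hom a b) : cell (k ⊙ i1 a) (i1 b ⊙ k) := vinv (lu k) ∘ ru k.

Lemma ucell_nat (a b : ob B) (k k' : hom a b) (x : cell k k') :
  ucell k' ∘ (x ▷ i1 a) = (i1 b ◁ x) ∘ ucell k.
Proof.
  by rewrite /ucell vcA ruN (pre2 (vconj (luN x))) vcA.
Qed.

Lemma paste_ucell (a b c : ob B) (k1 : hom a b) (k2 : hom b c) :
  paste (ucell k2) (ucell k1) = ucell (k2 ⊙ k1).
Proof.
  rewrite /paste /ucell -!lock !lwM !rwM !vcA ru_c1 lwV.
  rewrite -tri vcA vcKr vcKr rwV.
  by rewrite -lu_c1 vinv_vc vcA vcKr.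
Qed.

End Paste.

(** * Reconstruction of the unit and inverse constraints *)

(** The part of a morphism that concerns vertical and horizontal composition; [complete] extends it
    to a morphism. *)
Record Semi (A B : Bigroupoid) : Type := {
  S0 : ob A -> ob B;
  S1 : forall a a' : ob A, hom a a' -> hom (S0 a) (S0 a');
  S2 : forall (a a' : ob A) (f g : hom a a'), cell f g -> cell (S1 f) (S1 g);
  Spc : forall (a b c : ob A) (g : hom b c) (f : hom a b), cell (S1 g ⊙ S1 f) (S1 (g ⊙ f));
  S2_vc : forall (a a' : ob A) (f g h : hom a a') (y : cell g h) (x : cell f g),
      S2 (y ∘ x) = S2 y ∘ S2 x;
  Spc_nat : forall (a b c : ob A) (g g' : hom b c) (f f' : hom a b) (y : cell g g') (x : cell f f'),
      S2 (y ⋆ x) ∘ Spc g f = Spc g' f' ∘ (S2 y ⋆ S2 x);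
  Spc_asc : forall (a b c d : ob A) (h : hom c d) (g : hom b c) (f : hom a b),
      S2 (asc h g f) ∘ (Spc (h ⊙ g) f ∘ (Spc h g ▷ S1 f))
      = Spc h (g ⊙ f) ∘ ((S1 h ◁ Spc g f) ∘ asc (S1 h) (S1 g) (S1 f))
}.

Arguments S2 {A B} s {a a' f g} x.
Arguments Spc {A B} s {a b c} g f.

Definition semi_of (A B : Bigroupoid) (F : Morph A B) : Semi A B.
Proof.
refine {| S0 := F0 F; S1 := @F1 _ _ F; S2 := @F2 _ _ F; Spc := @phc _ _ F |}.
- exact: (F2_vc _ _ _ (m_laws _ _ F)).
- exact: (phc_nat _ _ _ (m_laws _ _ F)).
- by move=> *; rewrite -!vcA; apply: (M_asc _ _ _ (m_laws _ _ F)).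
Defined.

Section Complete.
Context {A B : Bigroupoid} (F : Semi A B).
Implicit Types a b c : ob A.

(** The left side is idempotent, hence an identity in a groupoid. *)
Lemma S2_id a a' (f : hom a a') : S2 F (idc f) = idc (S1 F f).
Proof.
  by apply: (vc_canl (x := S2 F (idc f))); rewrite -S2_vc !vc1r.
Qed.

Lemma S2_inv a a' (f g : hom a a') (x : cell f g) : S2 F (vinv x) = vinv (S2 F x).
Proof.
  by apply: (vc_canl (x := S2 F x)); rewrite -S2_vc !vcVr S2_id.
Qed.

Lemma Spc_natl a b c (g g' : hom b c) (f : hom a b) (y : cell g g') :
  S2 F (y ▷ f) ∘ Spc F g f = Spc F g' f ∘ (S2 F y ▷ S1 F f).
Proof. by rewrite Spc_nat S2_id. Qed.

Lemma Spc_natr a b c (g : hom b c) (f f' : hom a b) (x : cell f f') :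
  S2 F (g ◁ x) ∘ Spc F g f = Spc F g f' ∘ (S1 F g ◁ S2 F x).
Proof. by rewrite Spc_nat S2_id. Qed.

(** The unique solution of the right unit law at the 1-cell [i1 a]. *)
Definition unit_cell a : cell (i1 (S0 F a)) (S1 F (i1 a)) :=
  lfill (vinv (Spc F (i1 a) (i1 a)) ∘ (vinv (S2 F (ru (i1 a))) ∘ ru (S1 F (i1 a)))).

(** The unique solution of the compatibility law with [ev]. *)
Definition inv_cell a b (f : hom a b) : cell (inv1 (S1 F f)) (S1 F (inv1 f)) :=
  rfill (vinv (Spc F (inv1 f) f) ∘ (vinv (S2 F (ev f)) ∘ (unit_cell a ∘ ev (S1 F f)))).

Lemma unit_cell_i1 a :
  S2 F (ru (i1 a)) ∘ (Spc F (i1 a) (i1 a) ∘ (S1 F (i1 a) ◁ unit_cell a)) = ru (S1 F (i1 a)).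
Proof. by rewrite lfillK !vcKr. Qed.

(* By naturality along [ru f] it suffices to treat [f ⊙ i1 a], which reduces to the case [f = i1 a] by [ru_c1]. *)
Lemma unit_cell_ru a b (f : hom a b) :
  S2 F (ru f) ∘ (Spc F f (i1 a) ∘ (S1 F f ◁ unit_cell a)) = ru (S1 F f).
Proof.
  have nat (g g' : hom a b) (x : cell g g') :
      S2 F (ru g') ∘ (Spc F g' (i1 a) ∘ (S1 F g' ◁ unit_cell a)) ∘ (S2 F x ▷ i1 (S0 F a))
      = S2 F x ∘ (S2 F (ru g) ∘ (Spc F g (i1 a) ∘ (S1 F g ◁ unit_cell a))).
  { rewrite !vcA -exch (pre2 (eq_sym (Spc_natl _ _))) vcA !(pre2 (eq_sym (S2_vc _ _ _))).
    by rewrite ruN. }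
  have Fru : S2 F (ru (f ⊙ i1 a))
      ∘ (Spc F (f ⊙ i1 a) (i1 a) ∘ (S1 F (f ⊙ i1 a) ◁ unit_cell a)) = ru (S1 F (f ⊙ i1 a)).
  { apply: (vc_canr (x := Spc F f (i1 a) ▷ i1 (S0 F a))).
    rewrite ruN -!ru_c1 -unit_cell_i1 !lwM !vcA -exch S2_vc vcA.
    rewrite (pre3 (Spc_asc _ _ _ _)) !vcA (pre2 (Spc_natr _ _)) vcA.
    by rewrite ascr. }
  apply: (vc_canr (x := S2 F (ru f) ▷ i1 (S0 F a))).
  by rewrite nat Fru ruN.
Qed.

(** Whiskering with [S1 F (i1 b)] turns the left unit law into the right one, through the triangles
    of [A] and [B]. *)
Lemma unit_cell_lu a b (f : hom a b) :
  S2 F (lu f) ∘ (Spc F (i1 b) f ∘ (unit_cell b ▷ S1 F f)) = lu (S1 F f).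
Proof.
  apply: (lw_inj (f := S1 F (i1 b))).
  apply: (vc_canr (x := asc (S1 F (i1 b)) (i1 (S0 F b)) (S1 F f))).
  rewrite tri -unit_cell_ru !lwM !rwM !vcA -ascm.
  apply: (vc_canl (x := Spc F (i1 b) f)).
  rewrite (pre2 (eq_sym (Spc_natr _ _))) vcA (pre3 (eq_sym (Spc_asc _ _ _ _))) !vcA.
  by rewrite (pre2 (eq_sym (S2_vc _ _ _))) tri (pre2 (Spc_natl _ _)) vcA.
Qed.

Lemma inv_cell_ev a b (f : hom a b) :
  S2 F (ev f) ∘ (Spc F (inv1 f) f ∘ (inv_cell f ▷ S1 F f)) = unit_cell a ∘ ev (S1 F f).
Proof. by rewrite rfillK !vcKr. Qed.

(** After whiskering, both sides can be compared under [ev f'], where naturality of [ev] in [A] and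
    in [B] makes them agree. *)
Lemma inv_cell_nat a b (f f' : hom a b) (x : cell f f') :
  S2 F (inv2 x) ∘ inv_cell f = inv_cell f' ∘ inv2 (S2 F x).
Proof.
  apply: (rw_inj (f := S1 F f)); rewrite !rwM.
  apply: (vc_canl (x := S1 F (inv1 f') ◁ S2 F x)).
  rewrite (pre2 (eq_sym (hcE' (S2 F (inv2 x)) _))).
  rewrite (pre2 (eq_sym (exch (inv_cell f') _))) vcA -hcE'.
  apply: (vc_canl (x := Spc F (inv1 f') f')).
  rewrite (pre2 (eq_sym (Spc_nat _ _ _))) vcA.
  apply: (vc_canl (x := S2 F (ev f'))).
  rewrite (pre2 (eq_sym (S2_vc _ _ _))) (ev_nat _ (bg_laws A)) vc1l inv_cell_ev.
  rewrite (pre3 (inv_cell_ev _)) vcA.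
  by rewrite (ev_nat _ (bg_laws B)) vc1l.
Qed.

(** Whiskered with [S1 F f] and followed by the image of [ru f ∘ (f ◁ ev f) ∘ asc], both sides
    reduce to [lu (S1 F f)] by [inv_coh] in [A] and in [B]. *)
Lemma inv_cell_coev a b (f : hom a b) :
  S2 F (coev f) ∘ unit_cell b = Spc F f (inv1 f) ∘ ((S1 F f ◁ inv_cell f) ∘ coev (S1 F f)).
Proof.
  apply: (rw_inj (f := S1 F f)).
  apply: (vc_canl (x := S2 F (ru f) ∘ (S2 F (f ◁ ev f) ∘ (S2 F (asc f (inv1 f) f) ∘ Spc F _ _)))).
  rewrite !rwM !vcA (pre3 (Spc_asc _ _ _ _)) !vcA (pre2 (ascm _ _ _)) vcA.
  rewrite (pre2 (Spc_natr _ _)) vcA (pre2 (eq_sym (lwM _ _ _))) (pre2 (eq_sym (lwM _ _ _))) !vcA inv_cell_ev lwM vcA.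
  rewrite (pre3 (unit_cell_ru _)) inv_coh.
  rewrite (pre2 (eq_sym (Spc_natl _ _))) vcA !(pre2 (eq_sym (S2_vc _ _ _))) !vcA inv_coh.
  by rewrite unit_cell_lu.
Qed.

Definition complete : Morph A B.
Proof.
refine {| m_data := {| F0 := S0 F; F1 := @S1 _ _ F; F2 := @S2 _ _ F; phc := @Spc _ _ F;
                       ph1 := unit_cell; phi := inv_cell |} |}.
split=> /=; intros; rewrite ?vcA.
- exact: S2_id.
- exact: S2_vc.
- exact: Spc_nat.
- exact: inv_cell_nat.
- exact: Spc_asc.
- exact: unit_cell_ru.
- exact: unit_cell_lu.
- exact: inv_cell_ev.
- exact: inv_cell_coev.
Defined.

End Complete.

(** Packing a 1-cell with its endpoints allows a comparison of 1-cells whose endpoints are only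
    provably equal; [pk2] does the same one level up. *)
Definition pk1 (B : BGData) (x y : ob B) (f : hom x y) : {x : ob B & {y : ob B & hom x y}} :=
  existT _ x (existT _ y f).

Definition pk2 (B : BGData) (x y : ob B) (f g : hom x y) (c : cell f g) :
    {x : ob B & {y : ob B & {f : hom x y & {g : hom x y & cell f g}}}} :=
  existT _ x (existT _ y (existT _ f (existT _ g c))).

(** Uniqueness of identity proofs removes the packing once the endpoints coincide. *)
Lemma pk1_inj (B : BGData) (x y : ob B) (f g : hom x y) : pk1 f = pk1 g -> f = g.
Proof. by move=> H; do 2 apply inj_pair2 in H. Qed.

Lemma pk2_inj (B : BGData) (x y : ob B) (f g : hom x y) (c d : cell f g) : pk2 c = pk2 d -> c = d.
Proof. by move=> H; do 4 apply inj_pair2 in H. Qed.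

(** * Calculus of morphisms and a criterion for their equality *)

Section Morphisms.
Context {A B : Bigroupoid}.

Section Theory.
Context (F : Morph A B).
Implicit Types a b c d : ob A.

Lemma F2_1 a a' (f : hom a a') : F2 F (idc f) = idc (F1 F f).
Proof. exact: (S2_id (semi_of F)). Qed.

Lemma F2M a a' (f g h : hom a a') (y : cell g h) (x : cell f g) :
  F2 F (y ∘ x) = F2 F y ∘ F2 F x.
Proof. exact: (S2_vc (semi_of F)). Qed.

Lemma F2V a a' (f g : hom a a') (x : cell f g) : F2 F (vinv x) = vinv (F2 F x).
Proof. exact: (S2_inv (semi_of F)). Qed.

Lemma phcN a b c (g g' : hom b c) (f f' : hom a b) (y : cell g g') (x : cell f f') :
  F2 F (y ⋆ x) ∘ phc F g f = phc F g' f' ∘ (F2 F y ⋆ F2 F x).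
Proof. exact: (Spc_nat (semi_of F)). Qed.

Lemma phcNl a b c (g g' : hom b c) (f : hom a b) (y : cell g g') :
  F2 F (y ▷ f) ∘ phc F g f = phc F g' f ∘ (F2 F y ▷ F1 F f).
Proof. exact: (Spc_natl (semi_of F)). Qed.

Lemma phcNr a b c (g : hom b c) (f f' : hom a b) (x : cell f f') :
  F2 F (g ◁ x) ∘ phc F g f = phc F g f' ∘ (F1 F g ◁ F2 F x).
Proof. exact: (Spc_natr (semi_of F)). Qed.

Lemma phcA a b c d (h : hom c d) (g : hom b c) (f : hom a b) :
  F2 F (asc h g f) ∘ (phc F (h ⊙ g) f ∘ (phc F h g ▷ F1 F f))
  = phc F h (g ⊙ f) ∘ ((F1 F h ◁ phc F g f) ∘ asc (F1 F h) (F1 F g) (F1 F f)).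
Proof. exact: (Spc_asc (semi_of F)). Qed.

(** The image of a square under [F], with composition constraints inserted at both ends. *)
Definition Fsquare (u1 u2 v1 v2 : ob A) (h : hom u1 u2) (g : hom v1 v2)
    (e1 : hom v1 u1) (e2 : hom v2 u2) (t : cell (h ⊙ e1) (e2 ⊙ g)) :
    cell (F1 F h ⊙ F1 F e1) (F1 F e2 ⊙ F1 F g) :=
  vinv (phc F e2 g) ∘ (F2 F t ∘ phc F h e1).

Lemma Fsquare_nat (u1 u2 v1 v2 : ob A) (h h' : hom u1 u2) (g g' : hom v1 v2)
    (e1 : hom v1 u1) (e2 : hom v2 u2) (t : cell (h ⊙ e1) (e2 ⊙ g)) (t' : cell (h' ⊙ e1) (e2 ⊙ g'))
    (x : cell h h') (y : cell g g') :
  t' ∘ (x ▷ e1) = (e2 ◁ y) ∘ t ->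
  Fsquare t' ∘ (F2 F x ▷ F1 F e1) = (F1 F e2 ◁ F2 F y) ∘ Fsquare t.
Proof.
  move=> E; rewrite /Fsquare !vcA -phcNl (pre2 (eq_sym (F2M _ _))) E F2M vcA.
  by rewrite (pre2 (vconj (eq_sym (phcNr _ _)))) ?vcA.
Qed.

(** Each of the three associators in [paste] is carried across [F] by [phcA]. *)
Lemma paste_Fsquare (u1 u2 u3 v1 v2 v3 : ob A) (h1 : hom u1 u2) (h2 : hom u2 u3)
    (g1 : hom v1 v2) (g2 : hom v2 v3) (e1 : hom v1 u1) (e2 : hom v2 u2) (e3 : hom v3 u3)
    (t2 : cell (h2 ⊙ e2) (e3 ⊙ g2)) (t1 : cell (h1 ⊙ e1) (e2 ⊙ g1)) :
  (F1 F e3 ◁ phc F g2 g1) ∘ paste (Fsquare t2) (Fsquare t1)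
  = Fsquare (paste t2 t1) ∘ (phc F h2 h1 ▷ F1 F e1).
Proof.
  rewrite /paste /Fsquare -!lock !F2M !F2V !lwM !rwM !vcA.
  rewrite (phcA h2 h1 e1).
  apply: (vc_canl (x := phc F e3 (g2 ⊙ g1))); rewrite vcKr.
  rewrite (pre3 (eq_sym (phcA _ _ _))) !vcA; congr (_ ∘ _).
  rewrite rwV vcKr (pre2 (eq_sym (phcNl _ _))) vcA; congr (_ ∘ _).
  apply: (vc_canl (x := F2 F (asc h2 e2 g1))); rewrite vcKr (pre3 (phcA _ _ _)) !vcA vcKr.
  by rewrite lwV vcKr (pre2 (phcNr _ _)) vcA.
Qed.

End Theory.

(* The components [ph1] and [phi] of a morphism are determined by the rest. *)
Lemma morph_eq (M N : Morph A B) :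
  (forall a, F0 M a = F0 N a) ->
  (forall a a' (f : hom a a'), pk1 (F1 M f) = pk1 (F1 N f)) ->
  (forall a a' (f g : hom a a') (x : cell f g), pk2 (F2 M x) = pk2 (F2 N x)) ->
  (forall a b c (g : hom b c) (f : hom a b), pk2 (phc M g f) = pk2 (phc N g f)) ->
  M = N.
Proof.
  case: M N => [[m0 m1 m2 mp mu mi] lM] [[n0 n1 n2 np nu ni] lN] /=.
  (* The components are identified one level at a time: each substitution makes the types at the
     next level equal, so that the packing can be removed there. *)
  move=> /functional_extensionality e0; subst n0 => e1.
  have {}e1 : n1 = m1.
  { do 3 apply: functional_extensionality_dep => ?; apply: pk1_inj; exact: eq_sym (e1 _ _ _). }
  subst n1 => e2.
  have {}e2 : n2 = m2.
  { do 5 apply: functional_extensionality_dep => ?; apply: pk2_inj; exact: eq_sym (e2 _ _ _ _ _). }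
  subst n2 => ep.
  have {}ep : np = mp.
  { do 5 apply: functional_extensionality_dep => ?; apply: pk2_inj; exact: eq_sym (ep _ _ _ _ _). }
  subst np.
  have eu : nu = mu.
  { apply: functional_extensionality_dep => a; apply: (lw_inj (f := m1 _ _ (i1 a))).
    have := M_ru _ _ _ lM _ _ (i1 a); rewrite -(M_ru _ _ _ lN _ _ (i1 a)) /= !vcA.
    by move=> /vc_canl/vc_canl. }
  subst nu.
  have ei : ni = mi.
  { apply: functional_extensionality_dep => a; apply: functional_extensionality_dep => b.
    apply: functional_extensionality_dep => f; apply: (rw_inj (f := m1 _ _ f)).
    have := M_ev _ _ _ lM _ _ f; rewrite -(M_ev _ _ _ lN _ _ f) /= !vcA.
    by move=> /vc_canl/vc_canl. }
  by subst ni; rewrite (proof_irrelevance _ lM lN).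
Qed.

End Morphisms.

(** * Weak equivalences *)

Notation "G • F" := (compM _ _ _ G F) (at level 40, left associativity) : bg_scope.

Lemma compM_assoc (A B C D : Bigroupoid) (H : Morph C D) (G : Morph B C) (F : Morph A B) :
  (H • G) • F = H • (G • F).
Proof. by apply: morph_eq => //= a b c g f; rewrite F2M vcA. Qed.

Lemma compM_idl (A B : Bigroupoid) (F : Morph A B) : idM B • F = F.
Proof. by apply: morph_eq => //= a b c g f; rewrite vc1r. Qed.

Lemma compM_idr (A B : Bigroupoid) (F : Morph A B) : F • idM A = F.
Proof. by apply: morph_eq => //= a b c g f; rewrite F2_1 vc1l. Qed.

Definition iso1 (B : Bigroupoid) (a b : ob B) (f g : hom a b) : Prop := inhabited (cell f g).
Notation "f ≅ g" := (iso1 f g) (at level 70, no associativity) : bg_scope.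

Section Iso.
Context {B : Bigroupoid}.
Implicit Types a b c d : ob B.

Lemma iso_of a b (f g : hom a b) : cell f g -> f ≅ g.
Proof. by move=> x; exists. Qed.

Lemma iso_trans a b (f g h : hom a b) : f ≅ g -> g ≅ h -> f ≅ h.
Proof. by case=> x [y]; constructor; exact: (y ∘ x). Qed.

Lemma iso_lcan a b c (g : hom b c) (f f' : hom a b) : g ⊙ f ≅ g ⊙ f' -> f ≅ f'.
Proof. by case=> x; constructor; exact: (lfill x). Qed.

Lemma iso_rcan a b c (f : hom a b) (g g' : hom b c) : g ⊙ f ≅ g' ⊙ f -> g ≅ g'.
Proof. by case=> x; constructor; exact: (rfill x). Qed.

Definition linv_cell a b c (g : hom b c) (f : hom a c) : cell (g ⊙ (inv1 g ⊙ f)) f :=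
  lu f ∘ ((vinv (coev g) ▷ f) ∘ vinv (asc g (inv1 g) f)).

Definition rinv_cell a b c (f : hom a b) (g : hom a c) : cell ((g ⊙ inv1 f) ⊙ f) g :=
  ru g ∘ ((g ◁ ev f) ∘ asc g (inv1 f) f).

Lemma iso_linv a b c (g : hom b c) (f : hom a c) : g ⊙ (inv1 g ⊙ f) ≅ f.
Proof. exact: (iso_of (linv_cell g f)). Qed.

Lemma iso_rinv a b c (f : hom a b) (g : hom a c) : (g ⊙ inv1 f) ⊙ f ≅ g.
Proof. exact: (iso_of (rinv_cell f g)). Qed.

End Iso.

Lemma iso_F1 (A B : Bigroupoid) (F : Morph A B) (a b : ob A) (f g : hom a b) :
  f ≅ g -> F1 F f ≅ F1 F g.
Proof. by case=> x; constructor; exact: (F2 F x). Qed.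

Lemma iso_phc (A B : Bigroupoid) (F : Morph A B) (a b c : ob A) (g : hom b c) (f : hom a b) :
  F1 F g ⊙ F1 F f ≅ F1 F (g ⊙ f).
Proof. by constructor; exact: (phc F g f). Qed.

(** * Local equivalences *)

Section Local.
Context {A B : Bigroupoid} (F : Morph A B).

Definition faithful_at (a a' : ob A) : Prop :=
  forall (f g : hom a a') (x y : cell f g), F2 F x = F2 F y -> x = y.

Definition full_at (a a' : ob A) : Prop :=
  forall (f g : hom a a') (y : cell (F1 F f) (F1 F g)), exists x : cell f g, F2 F x = y.

Definition esurj_at (a a' : ob A) : Prop :=
  forall g : hom (F0 F a) (F0 F a'), exists f : hom a a', F1 F f ≅ g.

Definition local_equiv (a a' : ob A) : Prop :=
  esurj_at a a' /\ full_at a a' /\ faithful_at a a'.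

Definition bieq : Prop :=
  (forall b : ob B, exists a : ob A, inhabited (hom b (F0 F a)))
  /\ (forall a a' : ob A, local_equiv a a').

Lemma local_equiv_iff (a a' : ob A) : hom_functor_equivalence A B F a a' <-> local_equiv a a'.
Proof.
  split.
  - case=> G1 [G2 [eta [eps [G2_1 [G2M [etaN epsN]]]]]].
    (* [G2 x] determines [x], since [eps] makes [x] conjugate to the image of [G2 x]. *)
    have G2_inj g g' (x y : cell g g') : G2 _ _ x = G2 _ _ y -> x = y.
    { by move=> E; apply: (vc_canr (x := eps g)); rewrite -!epsN E. }
    split; [|split].
    + by move=> g; exists (G1 g); constructor; exact: eps g.
    + move=> f g y; exists (vinv (eta g) ∘ (G2 _ _ y ∘ eta f)).
      apply: G2_inj; apply: (vc_canr (x := eta f)).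
      by rewrite -etaN vcKr.
    + move=> f g x y E; apply: (vc_canl (x := eta g)).
      by rewrite !etaN E.
  - case=> es [fu fa].
    (* Choice of a quasi-inverse on objects; the inhabited type of 2-cells is restated as an
       existential so that a witness can be extracted. *)
    have inv g : {f : hom a a' & {y : cell (F1 F f) g | True}}.
    { case: (constructive_indefinite_description _ (es g)) => f H; exists f.
      have {H} : exists y : cell (F1 F f) g, True by case: H => y; exists y.
      by case/constructive_indefinite_description=> y _; exists y. }
    pose G1 g := projT1 (inv g); pose eps g : cell (F1 F (G1 g)) g := proj1_sig (projT2 (inv g)).
    pose lift f g y := constructive_indefinite_description _ (fu f g y).
    pose G2 g g' (y : cell g g') : cell (G1 g) (G1 g') :=
      proj1_sig (lift _ _ (vinv (eps g') ∘ (y ∘ eps g))).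
    have G2E g g' (y : cell g g') : F2 F (G2 g g' y) = vinv (eps g') ∘ (y ∘ eps g).
    { exact: proj2_sig (lift _ _ _). }
    pose eta f : cell f (G1 (F1 F f)) := proj1_sig (lift _ _ (vinv (eps (F1 F f)))).
    have etaE f : F2 F (eta f) = vinv (eps (F1 F f)).
    { exact: proj2_sig (lift _ _ _). }
    exists G1, G2, eta, eps; split; [|split; [|split]].
    + by move=> g; apply: fa; rewrite G2E vc1l vcVl F2_1.
    + by move=> g g' g'' y x; apply: fa; rewrite F2M !G2E !vcA vcKr.
    + by move=> f f' x; apply: fa; rewrite !F2M G2E !etaE !vcA vcVr vc1r.
    + by move=> g g' y; rewrite G2E vcKr.
Qed.

Lemma weak_equivalence_iff : weak_equivalence A B F <-> bieq.
Proof. by split; case=> e0 e; split=> // a a'; apply/local_equiv_iff. Qed.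

Lemma F2_lw (a b c : ob A) (g : hom b c) (f f' : hom a b) (x : cell f f') :
  F2 F (g ◁ x) = phc F g f' ∘ ((F1 F g ◁ F2 F x) ∘ vinv (phc F g f)).
Proof. by apply: (vc_canr (x := phc F g f)); rewrite phcNr !vcA vcVl vc1r. Qed.

Lemma F2_rw (a b c : ob A) (g g' : hom b c) (f : hom a b) (y : cell g g') :
  F2 F (y ▷ f) = phc F g' f ∘ ((F2 F y ▷ F1 F f) ∘ vinv (phc F g f)).
Proof. by apply: (vc_canr (x := phc F g f)); rewrite phcNl !vcA vcVl vc1r. Qed.

(** Whiskering by [e] and by its image is bijective on 2-cells, so local equivalence is carried from
    one 0-cell to another along a 1-cell. *)
Lemma local_equiv_postcomp (a b c : ob A) : hom b c -> local_equiv a c -> local_equiv a b.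
Proof.
  move=> e [es [fu fa]]; split; [|split].
  - move=> l; case: (es (F1 F e ⊙ l)) => m Em; exists (inv1 e ⊙ m).
    apply: (iso_lcan (g := F1 F e)); apply: iso_trans Em.
    by apply: iso_trans (iso_phc _ _ _) _; apply: iso_F1; apply: iso_linv.
  - move=> f g y.
    case: (fu _ _ (phc F e g ∘ ((F1 F e ◁ y) ∘ vinv (phc F e f)))) => z Ez.
    exists (lfill z); apply: (lw_inj (f := F1 F e)).
    apply: (vc_canl (x := phc F e g)); apply: (vc_canr (x := vinv (phc F e f))).
    by rewrite vcA -F2_lw lfillK vcA.
  - move=> f g x y E; apply: (lw_inj (f := e)); apply: fa.
    by rewrite !F2_lw E.
Qed.

Lemma local_equiv_precomp (a b c : ob A) : hom a c -> local_equiv c b -> local_equiv a b.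
Proof.
  move=> e [es [fu fa]]; split; [|split].
  - move=> l; case: (es (l ⊙ F1 F (inv1 e))) => m Em; exists (m ⊙ e).
    apply: (iso_rcan (f := F1 F (inv1 e))); apply: iso_trans Em.
    apply: iso_trans (iso_phc _ _ _) _; apply: iso_F1.
    apply: (iso_rcan (f := e)); exact: iso_rinv.
  - move=> f g y.
    case: (fu _ _ (phc F g (inv1 e) ∘ ((y ▷ F1 F (inv1 e)) ∘ vinv (phc F f (inv1 e))))) => z Ez.
    exists (rfill z); apply: (rw_inj (f := F1 F (inv1 e))).
    apply: (vc_canl (x := phc F g (inv1 e))); apply: (vc_canr (x := vinv (phc F f (inv1 e)))).
    by rewrite vcA -F2_rw rfillK vcA.
  - move=> f g x y E; apply: (rw_inj (f := inv1 e)); apply: fa.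
    by rewrite !F2_rw E.
Qed.

End Local.

Lemma bieq_id (A : Bigroupoid) : bieq (idM A).
Proof.
  split=> [a|a a']; first by exists a; constructor; exact: i1.
  split; [|split] => //.
  - by move=> g; exists g; constructor; exact: idc.
  - by move=> f g y; exists y.
Qed.

(** * Composition and cancellation of biequivalences *)

Section Cancel.
Context {A B C : Bigroupoid} (F : Morph A B) (G : Morph B C).

Lemma bieq_comp : bieq F -> bieq G -> bieq (G • F).
Proof.
  case=> F_0 F_loc [G_0 G_loc]; split=> [c|a a'].
  - case: (G_0 c) => b [g]; case: (F_0 b) => a [f].
    by exists a; constructor; exact: (F1 G f ⊙ g).
  - case: (F_loc a a') => Fes [Ffu Ffa]; case: (G_loc (F0 F a) (F0 F a')) => Ges [Gfu Gfa].
    split; [|split].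
    + move=> g; case: (Ges g) => h Eh; case: (Fes h) => f Ef; exists f.
      by apply: iso_trans Eh; apply: iso_F1.
    + move=> f g y; case: (Gfu _ _ y) => z <-; case: (Ffu _ _ z) => x <-.
      by exists x.
    + by move=> f g x y E; apply: Ffa; apply: Gfa.
Qed.

(* On the image of an essentially surjective and full [F], the 2-cells hit by [G] are those hit by [G • F]. *)
Lemma faithful_at_image (a a' : ob A) :
  esurj_at F a a' -> full_at F a a' -> faithful_at (G • F) a a' ->
  faithful_at G (F0 F a) (F0 F a').
Proof.
  move=> es fu fa m m' y y' E.
  case: (es m) (es m') => k [c] [k' [c']].
  case: (fu _ _ (vinv c' ∘ (y ∘ c))) => x Ex.
  case: (fu _ _ (vinv c' ∘ (y' ∘ c))) => x' Ex'.
  have : F2 F x = F2 F x' by congr (F2 F _); apply: fa; rewrite /= Ex Ex' !F2M E.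
  by rewrite Ex Ex' => /vc_canl/vc_canr.
Qed.

(** Every 0-cell of [B] has a 1-cell to the image of [F], which reduces the local claim to 0-cells
    in that image; there 1-cells are images up to isomorphism, and 2-cells are conjugated
    accordingly. *)
Lemma bieq_cancelr : bieq F -> bieq (G • F) -> bieq G.
Proof.
  case=> F_0 F_loc [H_0 H_loc]; split=> [c|b b'].
  - by case: (H_0 c) => a ?; exists (F0 F a).
  - case: (F_0 b) (F_0 b') => a [e] [a' [e']].
    apply: (local_equiv_precomp e); apply: (local_equiv_postcomp e').
    case: (F_loc a a') => Fes [Ffu Ffa]; case: (H_loc a a') => Hes [Hfu Hfa].
    split; [|split].
    + by move=> l; case: (Hes l) => k; exists (F1 F k).
    + move=> m m' y; case: (Fes m) (Fes m') => k [c] [k' [c']].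
      case: (Hfu _ _ (vinv (F2 G c') ∘ (y ∘ F2 G c))) => x /= Ex.
      exists (c' ∘ (F2 F x ∘ vinv c)).
      by rewrite !F2M Ex !F2V !vcA vcKr vcVr vc1r.
    + exact: faithful_at_image.
Qed.

Lemma bieq_cancell : bieq G -> bieq (G • F) -> bieq F.
Proof.
  case=> G_0 G_loc [H_0 H_loc]; split=> [b|a a'].
  - case: (H_0 (F0 G b)) => a [h]; case: (G_loc b (F0 F a)) => Ges _.
    by case: (Ges h) => k _; exists a; constructor.
  - case: (G_loc (F0 F a) (F0 F a')) => Ges [Gfu Gfa]; case: (H_loc a a') => Hes [Hfu Hfa].
    split; [|split].
    + move=> l; case: (Hes (F1 G l)) => k [c]; exists k; case: (Gfu _ _ c) => x _.
      by constructor.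
    + by move=> f g y; case: (Hfu _ _ (F2 G y)) => x /Gfa; exists x.
    + by move=> f g x y E; apply: Hfa; rewrite /= E.
Qed.

End Cancel.

(** [H] is faithful on the image of [G • F], hence [G] is full on the image of [F], so isomorphisms
    found after [G] come from [B]. Isomorphisms and retracts of biequivalences are handled by this
    lemma. *)
Lemma bieq_two_of_six (A B C D : Bigroupoid) (F : Morph A B) (G : Morph B C) (H : Morph C D) :
  bieq (G • F) -> bieq (H • G) -> bieq F.
Proof.
  case=> P_0 P_loc [Q_0 Q_loc]; split=> [b|a a'].
  - case: (P_0 (F0 G b)) => a [h]; case: (Q_loc b (F0 F a)) => Qes _.
    by case: (Qes (F1 H h)) => k _; exists a; constructor.
  - case: (P_loc a a') => Pes [Pfu Pfa]; case: (Q_loc (F0 F a) (F0 F a')) => Qes [Qfu Qfa].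
    have Hfa : faithful_at H (F0 G (F0 F a)) (F0 G (F0 F a')).
    { apply: (faithful_at_image (F := G • F)) => // f g x y E.
      by apply: Pfa; congr (F2 G _); apply: Qfa. }
    have Gfu : full_at G (F0 F a) (F0 F a').
    { by move=> f g y; case: (Qfu _ _ (F2 H y)) => x /Hfa; exists x. }
    split; [|split].
    + move=> l; case: (Pes (F1 G l)) => k [c]; exists k; case: (Gfu _ _ c) => x _.
      by constructor.
    + move=> f g y; case: (Pfu _ _ (F2 G y)) => x Ex; exists x.
      by apply: Qfa; rewrite /= -Ex.
    + by move=> f g x y E; apply: Pfa; rewrite /= E.
Qed.

Lemma two_out_of_three_weak_equivalence : two_out_of_three Bigpd weak_equivalence.
Proof.
  move=> X Y Z F G; rewrite !weak_equivalence_iff; split; [|split].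
  - exact: bieq_comp.
  - exact: bieq_cancelr.
  - exact: bieq_cancell.
Qed.

Lemma iso_weak_equivalence (X Y : Bigroupoid) (F : Morph X Y) :
  is_iso Bigpd X Y F -> weak_equivalence X Y F.
Proof.
  case=> G [E1 E2]; apply/weak_equivalence_iff; apply: (bieq_two_of_six (G := G) (H := F)).
  - by rewrite [_ • _]E1; exact: bieq_id.
  - by rewrite [_ • _]E2; exact: bieq_id.
Qed.

(** * Trivial fibrations *)

Definition tfib (X Y : Bigroupoid) (p : Morph X Y) : Prop :=
  (forall y : ob Y, exists x : ob X, F0 p x = y)
  /\ (forall (x x' : ob X) (g : hom (F0 p x) (F0 p x')), exists f : hom x x', F1 p f = g)
  /\ (forall x x' : ob X, full_at p x x')
  /\ (forall x x' : ob X, faithful_at p x x').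

(** Lifting makes essential surjectivity strict: the source of a lift of a 1-cell [y -> p x] is a
    preimage of [y], and likewise for 2-cells. *)
Lemma tfib_iff (X Y : Bigroupoid) (p : Morph X Y) :
  fibration X Y p /\ weak_equivalence X Y p <-> tfib p.
Proof.
  rewrite weak_equivalence_iff; split.
  - case=> [[lift0 lift1] [p_0 p_loc]]; split; [|split; [|split]].
    + move=> y; case: (p_0 y) => x [g]; case: (lift0 _ _ g) => x0 [f] /(f_equal (@projT1 _ _)) /= E.
      by exists x0.
    + move=> x x' g; case: (p_loc x x') => es _; case: (es g) => f [c].
      case: (lift1 _ _ _ _ (vinv c)) => k [al] /(f_equal (@projT1 _ _)) /= E.
      by exists k.
    + by move=> x x'; case: (p_loc x x') => _ [].
    + by move=> x x'; case: (p_loc x x') => _ [].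
  - case=> surj0 [surj1 [fu fa]]; split; split.
    + move=> x' b0; case: (surj0 b0) => x <- b; case: (surj1 _ _ b) => f <-.
      by exists x, f.
    + move=> x x' f' b; case: (surj1 _ _ b) => f <- beta; case: (fu _ _ _ _ beta) => al <-.
      by exists f, al.
    + by move=> y; case: (surj0 y) => x <-; exists x; constructor; exact: i1.
    + move=> x x'; split; [|split] => //.
      by move=> g; case: (surj1 _ _ g) => f <-; exists f; constructor; exact: idc.
Qed.

(** * Transport along provable equalities of cells *)

Lemma pk1_ind (B : BGData) (x y : ob B) (c : hom x y) (P : forall x' y' : ob B, hom x' y' -> Prop) :
  P x y c -> forall (x' y' : ob B) (d : hom x' y'), pk1 c = pk1 d -> P x' y' d.
Proof.
  move=> Pc x' y' d E.
  exact: (@eq_ind _ (pk1 c) (fun t => P _ _ (projT2 (projT2 t))) Pc _ E).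
Qed.

Lemma pk1_transport (B : BGData) (x y x' y' : ob B) (f : hom x' y') :
  x' = x -> y' = y -> exists f0 : hom x y, pk1 f0 = pk1 f.
Proof. by move=> <- <-; exists f. Qed.

Lemma pk1_c1 (B : BGData) (x y z x' y' z' : ob B) (g : hom y z) (f : hom x y)
    (g' : hom y' z') (f' : hom x' y') :
  pk1 g = pk1 g' -> pk1 f = pk1 f' -> pk1 (g ⊙ f) = pk1 (g' ⊙ f').
Proof.
  move=> Eg Ef.
  move: y' z' g' Eg f' Ef; apply: pk1_ind => f' Ef.
  have Ex : x = x' by exact: (f_equal (@projT1 _ _) Ef).
  by subst x'; rewrite (pk1_inj Ef).
Qed.

Lemma F1_pk1 (A B : BGData) (F : MorphData A B) (x y x' y' : ob A) (f : hom x y) (f' : hom x' y') :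
  pk1 f = pk1 f' -> pk1 (F1 F f) = pk1 (F1 F f').
Proof. by move: x' y' f'; apply: pk1_ind. Qed.

(** Fullness when source and target are known only up to packing. The extra factor [k] is an
    identity for [lift2] and [phc p] for [lift_phc]. *)
Lemma full_transport (X Y : Bigroupoid) (p : Morph X Y) (x x' : ob X) (y y' : ob Y)
    (f f' : hom x x') (c : hom (F0 p x) (F0 p x')) (k : cell c (F1 p f)) (d d' : hom y y')
    (t : cell d d') :
  full_at p x x' -> pk1 c = pk1 d -> pk1 (F1 p f') = pk1 d' ->
  exists al : cell f f', pk2 (F2 p al ∘ k) = pk2 t.
Proof.
  move=> fu Ec; move: y y' d Ec d' t; apply: pk1_ind => d' t Ed'.
  move: (pk1_inj Ed') => ?; subst d'; case: (fu _ _ (t ∘ vinv k)) => al Eal; exists al.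
  by rewrite Eal vcA vcVl vc1r.
Qed.

(** Applied to the image under [p] of the chosen lifts, which agrees with [v] only in packed
    form. *)
Lemma semi_laws_transport (B Y : Bigroupoid) (v : Morph B Y)
    (W0 : ob B -> ob Y) (W1 : forall b b' : ob B, hom b b' -> hom (W0 b) (W0 b'))
    (W2 : forall (b b' : ob B) (f g : hom b b'), cell f g -> cell (W1 _ _ f) (W1 _ _ g))
    (Wpc : forall (a b c : ob B) (g : hom b c) (f : hom a b),
      cell (W1 _ _ g ⊙ W1 _ _ f) (W1 _ _ (g ⊙ f))) :
  (forall b, W0 b = F0 v b) ->
  (forall b b' (f : hom b b'), pk1 (W1 _ _ f) = pk1 (F1 v f)) ->
  (forall b b' (f g : hom b b') (x : cell f g), pk2 (W2 _ _ _ _ x) = pk2 (F2 v x)) ->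
  (forall a b c (g : hom b c) (f : hom a b), pk2 (Wpc _ _ _ g f) = pk2 (phc v g f)) ->
  (forall (a a' : ob B) (f g h : hom a a') (y : cell g h) (x : cell f g),
      W2 _ _ _ _ (y ∘ x) = W2 _ _ _ _ y ∘ W2 _ _ _ _ x) /\
  (forall (a b c : ob B) (g g' : hom b c) (f f' : hom a b) (y : cell g g') (x : cell f f'),
      W2 _ _ _ _ (y ⋆ x) ∘ Wpc _ _ _ g f = Wpc _ _ _ g' f' ∘ (W2 _ _ _ _ y ⋆ W2 _ _ _ _ x)) /\
  (forall (a b c d : ob B) (h : hom c d) (g : hom b c) (f : hom a b),
      W2 _ _ _ _ (asc h g f) ∘ (Wpc _ _ _ (h ⊙ g) f ∘ (Wpc _ _ _ h g ▷ W1 _ _ f))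
      = Wpc _ _ _ h (g ⊙ f) ∘ ((W1 _ _ h ◁ Wpc _ _ _ g f)
          ∘ asc (W1 _ _ h) (W1 _ _ g) (W1 _ _ f))).
Proof.
  case: v => [[m0 m1 m2 mp mu mi] lM] /=.
  move=> /functional_extensionality e0; subst W0 => e1.
  have {}e1 : W1 = m1.
  { do 3 apply: functional_extensionality_dep => ?; apply: pk1_inj; exact: e1. }
  subst W1 => e2.
  have {}e2 : W2 = m2.
  { do 5 apply: functional_extensionality_dep => ?; apply: pk2_inj; exact: e2. }
  subst W2 => ep.
  have {}ep : Wpc = mp.
  { do 5 apply: functional_extensionality_dep => ?; apply: pk2_inj; exact: ep. }
  subst Wpc; split; [|split].
  - exact: (F2M (Build_Morph _ _ _ lM)).
  - exact: (phcN (Build_Morph _ _ _ lM)).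
  - exact: (phcA (Build_Morph _ _ _ lM)).
Qed.

(** Agreement of 2-cells and constraints is tested after [p], which reflects it. *)
Lemma morph_eq_faithful (A X Y : Bigroupoid) (p : Morph X Y) (M N : Morph A X) :
  (forall x x', faithful_at p x x') ->
  (forall a, F0 M a = F0 N a) ->
  (forall a a' (f : hom a a'), pk1 (F1 M f) = pk1 (F1 N f)) ->
  p • M = p • N -> M = N.
Proof.
  move=> fa e0 e1 E; apply: morph_eq => //.
  - have E2 a a' (f g : hom a a') (x : cell f g) := f_equal (fun P : Morph A Y => pk2 (F2 P x)) E.
    case: M N e0 e1 {E} E2 => [[m0 m1 m2 mp mu mi] lM] [[n0 n1 n2 np nu ni] lN] /=.
    move=> /functional_extensionality e0; subst n0 => e1.
    have {}e1 : n1 = m1.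
    { do 3 apply: functional_extensionality_dep => ?; apply: pk1_inj; exact: eq_sym (e1 _ _ _). }
    subst n1 => E2 a a' f g x; congr pk2; apply: fa; apply: pk2_inj; exact: E2.
  - have Ep a b c (g : hom b c) (f : hom a b) := f_equal (fun P : Morph A Y => pk2 (phc P g f)) E.
    case: M N e0 e1 {E} Ep => [[m0 m1 m2 mp mu mi] lM] [[n0 n1 n2 np nu ni] lN] /=.
    move=> /functional_extensionality e0; subst n0 => e1.
    have {}e1 : n1 = m1.
    { do 3 apply: functional_extensionality_dep => ?; apply: pk1_inj; exact: eq_sym (e1 _ _ _). }
    subst n1 => Ep a b c g f; congr pk2; apply: fa.
    by apply: (vc_canr (x := phc p (m1 _ _ g) (m1 _ _ f))); apply: pk2_inj; exact: Ep.
Qed.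

(** * Lifting cofibrations against trivial fibrations *)

Section LiftCofibration.
Context (A B X Y : Bigroupoid) (i : Morph A B) (p : Morph X Y).
Context (cof_i : cofibration A B i).
Context (tf_p : tfib p).
Context (u : Morph A X) (v : Morph B Y).
Context (sq : p • u = v • i).

Lemma cofibration_pk1_inj (a b a' b' : ob A) (k : hom a b) (k' : hom a' b') :
  pk1 (F1 i k) = pk1 (F1 i k') -> pk1 k = pk1 k'.
Proof.
  case: cof_i => inj0 inj1 E.
  have Ea : a = a' by apply: inj0; exact: (f_equal (@projT1 _ _) E).
  have Eb : b = b' by apply: inj0; exact: (f_equal (fun t => projT1 (projT2 t)) E).
  by subst a' b'; congr pk1; apply: inj1; apply: pk1_inj.
Qed.

Lemma lift0_ex (b : ob B) :
  {x : ob X | F0 p x = F0 v b /\ forall a, F0 i a = b -> x = F0 u a}.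
Proof.
  apply: constructive_indefinite_description.
  (* On the image of [i] the value is prescribed by [u], consistently because [i] is injective;
     elsewhere any preimage under [p] serves. *)
  case: (classic (exists a, F0 i a = b)) => [[a <-]|nb].
  - exists (F0 u a); split; first exact: (f_equal (fun P : Morph A Y => F0 P a) sq).
    by move=> a' /(proj1 cof_i) ->.
  - case: tf_p => surj0 _; case: (surj0 (F0 v b)) => x Ex; exists x; split=> // a Ea.
    by case: nb; exists a.
Qed.

Definition lift0 (b : ob B) : ob X := proj1_sig (lift0_ex b).

Lemma lift0_p (b : ob B) : F0 p (lift0 b) = F0 v b.
Proof. exact: (proj1 (proj2_sig (lift0_ex b))). Qed.

Lemma lift0_i (a : ob A) : lift0 (F0 i a) = F0 u a.
Proof. exact: (proj2 (proj2_sig (lift0_ex (F0 i a))) a). Qed.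

Lemma lift1_ex (b b' : ob B) (g : hom b b') :
  {f : hom (lift0 b) (lift0 b') | pk1 (F1 p f) = pk1 (F1 v g)
     /\ forall a a' (k : hom a a'), pk1 (F1 i k) = pk1 g -> pk1 f = pk1 (F1 u k)}.
Proof.
  apply: constructive_indefinite_description.
  case: (classic (exists a a' (k : hom a a'), pk1 (F1 i k) = pk1 g)) => [[a [a' [k Ek]]]|ng].
  (* This replaces [g] by [F1 i k] together with its endpoints; [F1 u k] then only has to be moved
     along [lift0_i]. *)
  - move: b b' g Ek; apply: pk1_ind.
    case: (pk1_transport (F1 u k) (eq_sym (lift0_i a)) (eq_sym (lift0_i a'))) => f Ef.
    exists f; split.
    + rewrite (F1_pk1 p Ef); exact: (f_equal (fun P : Morph A Y => pk1 (F1 P k)) sq).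
    + by move=> b b' l /cofibration_pk1_inj El; rewrite Ef (F1_pk1 u El).
  - case: tf_p => _ [surj1 _].
    case: (pk1_transport (F1 v g) (eq_sym (lift0_p b)) (eq_sym (lift0_p b'))) => f0 Ef0.
    case: (surj1 _ _ f0) => f Ef; exists f; rewrite Ef; split=> // a a' k Ek.
    by case: ng; exists a, a', k.
Qed.

Definition lift1 (b b' : ob B) (g : hom b b') : hom (lift0 b) (lift0 b') := proj1_sig (lift1_ex g).

Lemma lift1_p (b b' : ob B) (g : hom b b') : pk1 (F1 p (lift1 g)) = pk1 (F1 v g).
Proof. exact: (proj1 (proj2_sig (lift1_ex g))). Qed.

Lemma lift1_i (a a' : ob A) (k : hom a a') : pk1 (lift1 (F1 i k)) = pk1 (F1 u k).
Proof. exact: (proj2 (proj2_sig (lift1_ex (F1 i k))) a a' k). Qed.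

Lemma lift2_ex (b b' : ob B) (g g' : hom b b') (y : cell g g') :
  {x : cell (lift1 g) (lift1 g') | pk2 (F2 p x) = pk2 (F2 v y)}.
Proof.
  apply: constructive_indefinite_description.
  case: tf_p => _ [_ [fu _]].
  case: (full_transport (idc _) (F2 v y) (fu _ _) (lift1_p g) (lift1_p g')) => x Ex.
  by exists x; rewrite -Ex vc1r.
Qed.

Definition lift2 (b b' : ob B) (g g' : hom b b') (y : cell g g') : cell (lift1 g) (lift1 g') :=
  proj1_sig (lift2_ex y).

Lemma lift2_p (b b' : ob B) (g g' : hom b b') (y : cell g g') : pk2 (F2 p (lift2 y)) = pk2 (F2 v y).
Proof. exact: (proj2_sig (lift2_ex y)). Qed.

Lemma lift_phc_ex (a b c : ob B) (g : hom b c) (f : hom a b) :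
  {x : cell (lift1 g ⊙ lift1 f) (lift1 (g ⊙ f)) |
     pk2 (F2 p x ∘ phc p (lift1 g) (lift1 f)) = pk2 (phc v g f)}.
Proof.
  apply: constructive_indefinite_description.
  case: tf_p => _ [_ [fu _]].
  exact: (full_transport _ _ (fu _ _) (pk1_c1 (lift1_p g) (lift1_p f)) (lift1_p (g ⊙ f))).
Qed.

Definition lift_phc (a b c : ob B) (g : hom b c) (f : hom a b) :
    cell (lift1 g ⊙ lift1 f) (lift1 (g ⊙ f)) :=
  proj1_sig (lift_phc_ex g f).

Lemma lift_phc_p (a b c : ob B) (g : hom b c) (f : hom a b) :
  pk2 (F2 p (lift_phc g f) ∘ phc p (lift1 g) (lift1 f)) = pk2 (phc v g f).
Proof. exact: (proj2_sig (lift_phc_ex g f)). Qed.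

(** As [p] is locally faithful, each law may be checked after applying [p], where it becomes the law
    for [v]. *)
Definition lift_semi : Semi B X.
Proof.
refine {| S0 := lift0; S1 := lift1; S2 := lift2; Spc := lift_phc |};
  case: (semi_laws_transport lift0_p lift1_p lift2_p lift_phc_p) => pM [pN pA];
  case: tf_p => _ [_ [_ fa]].
- by move=> *; apply: fa; rewrite F2M.
- move=> a b c g g' f f' y x; apply: fa.
  apply: (vc_canr (x := phc p (lift1 g) (lift1 f))).
  by rewrite !F2M !vcA pN phcN vcA.
- move=> a b c d h g f; apply: fa.
  apply: (vc_canr (x := phc p (lift1 h ⊙ lift1 g) (lift1 f) ∘ (phc p (lift1 h) (lift1 g) ▷ _))).
  rewrite !F2M !vcA (pre2 (phcNl p _ _)) vcA -rwM.
  have := pA _ _ _ _ h g f; rewrite !vcA => ->.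
  by rewrite phcA (pre2 (phcNr p _ _)) vcA (pre2 (eq_sym (lwM _ _ _))).
Defined.

Lemma tfib_lift : exists h : Morph B X, h • i = u /\ p • h = v.
Proof.
  have ph : p • complete lift_semi = v.
  { apply: morph_eq => //=.
    - exact: lift0_p.
    - exact: lift1_p.
    - exact: lift2_p.
    - exact: lift_phc_p. }
  exists (complete lift_semi); split=> //.
  case: tf_p => _ [_ [_ fa]]; apply: (morph_eq_faithful fa).
  - exact: lift0_i.
  - exact: lift1_i.
  - by rewrite -compM_assoc ph sq.
Qed.

End LiftCofibration.

(** * Cofibrations and trivial fibrations *)

Section CofibrationFactor.
Context (A B : Bigroupoid) (F : Morph A B).

Definition cyl_ob : Type := (ob A + ob B)%type.

Definition cyl_ev (x : cyl_ob) : ob B :=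
  match x with inl a => F0 F a | inr b => b end.

Definition cyl_new (x y : cyl_ob) : Type :=
  match x, y with inl a, inl a' => hom a a' | _, _ => Empty_set end.

Definition cyl_new_ev (x y : cyl_ob) : cyl_new x y -> hom (cyl_ev x) (cyl_ev y) :=
  match x, y with
  | inl a, inl a' => fun k : hom a a' => F1 F k
  | _, _ => fun k => match k with end
  end.

(* Freshly added copies of the 1-cells of [A]; every operation on 1-cells lands in the left summand. *)
Definition cyl_hom (x y : cyl_ob) : Type := (hom (cyl_ev x) (cyl_ev y) + cyl_new x y)%type.

Definition cyl_ev1 (x y : cyl_ob) (g : cyl_hom x y) : hom (cyl_ev x) (cyl_ev y) :=
  match g with inl g => g | inr k => cyl_new_ev k end.

Definition cyl_data : BGData := {|
  ob := cyl_ob;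
  hom := cyl_hom;
  cell := fun x y f g => cell (cyl_ev1 f) (cyl_ev1 g);
  vc := fun x y f g h c d => c ∘ d;
  idc := fun x y f => idc (cyl_ev1 f);
  vinv := fun x y f g c => vinv c;
  c1 := fun x y z g f => inl (cyl_ev1 g ⊙ cyl_ev1 f);
  hc := fun x y z g g' f f' c d => c ⋆ d;
  i1 := fun x => inl (i1 (cyl_ev x));
  inv1 := fun x y f => inl (inv1 (cyl_ev1 f));
  inv2 := fun x y f g c => inv2 c;
  asc := fun x y z w h g f => asc (cyl_ev1 h) (cyl_ev1 g) (cyl_ev1 f);
  lu := fun x y f => lu (cyl_ev1 f);
  ru := fun x y f => ru (cyl_ev1 f);
  ev := fun x y f => ev (cyl_ev1 f);
  coev := fun x y f => coev (cyl_ev1 f)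
|}.

(** All 2-cells are taken at evaluated 1-cells, so each law is an instance of the same law in
    [B]. *)
Lemma cyl_laws : BGLaws cyl_data.
Proof. by case: (bg_laws B) => *; split=> /=; intros; auto. Qed.

Definition cyl : Bigroupoid := {| bg_data := cyl_data; bg_laws := cyl_laws |}.

Definition cyl_in : Morph A cyl.
Proof.
refine {| m_data := @Build_MorphData A cyl (fun a => inl a) (fun a a' k => inr k)
  (fun a a' f g x => F2 F x) (fun a b c g f => phc F g f) (fun a => ph1 F a) (fun a b f => phi F f) |}.
case: (m_laws _ _ F) => *; split=> /=; auto.
Defined.

Definition cyl_out : Morph cyl B.
Proof.
apply: complete; refine (@Build_Semi cyl B cyl_ev cyl_ev1 (fun x y f g c => c)
  (fun x y z g f => idc _) _ _ _) => /=.
- by [].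
- by move=> *; rewrite vc1l vc1r.
- by move=> *; rewrite !hc11 !vc1l !vc1r.
Defined.

Lemma cyl_factor : cyl_out • cyl_in = F.
Proof. by apply: morph_eq => //= a b c g f; rewrite vc1r. Qed.

Lemma cyl_in_cofibration : cofibration A cyl cyl_in.
Proof.
  split; first by move=> a a' [].
  move=> a a' k k' E.
  exact: (f_equal (fun g : cyl_hom (inl a) (inl a') => match g with inl _ => k | inr l => l end) E).
Qed.

Lemma cyl_out_tfib : tfib cyl_out.
Proof.
  split; [|split; [|split]].
  - by move=> b; exists (inr b).
  - by move=> x y g; exists (inl g).
  - by move=> x y f g c; exists c.
  - by move=> x y f g c d E; exact: E.
Qed.

End CofibrationFactor.

(** * Closure under retracts *)

Section Retracts.
Context (A B E : Bigroupoid) (i : Morph A B) (j : Morph A E) (p : Morph E B).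

Lemma cofibration_retract (h : Morph B E) : h • i = j -> cofibration A E j -> cofibration A B i.
Proof.
  move=> <- [/= inj0 inj1]; split=> [a a' E0|a a' k k' E1].
  - by apply: inj0; rewrite E0.
  - by apply: inj1; rewrite E1.
Qed.

Lemma bieq_retract (h : Morph B E) : h • i = j -> p • h = idM B -> bieq j -> bieq i.
Proof.
  move=> Ej Eid bj; apply: (bieq_two_of_six (G := h) (H := p)).
  - by rewrite Ej.
  - by rewrite Eid; exact: bieq_id.
Qed.

Lemma fibration_retract (h : Morph E A) : h • j = idM A -> i • h = p -> fibration E B p ->
  fibration A B i.
Proof.
  move=> Eid <- [/= fib0 fib1]; split.
  (* With [h • j] written in the place of the identity, one rewriting with [Eid] changes all
     dependent types at once. *)
  - suff: forall (a : ob A) b0 (b : hom b0 (F0 i (F0 (h • j) a))),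
      exists (a0 : ob A) (f : hom a0 (F0 (h • j) a)),
       existT (fun x : ob B => hom x _) (F0 i a0) (F1 i f) = existT _ b0 b by rewrite Eid.
    move=> a b0 b; case: (fib0 _ _ b) => e0 [e Ee].
    by exists (F0 h e0), (F1 h e).
  - suff: forall (a0 a1 : ob A) (a' : hom a0 a1) (b : hom (F0 i (F0 (h • j) a0)) (F0 i (F0 (h • j) a1)))
          (beta : cell b (F1 i (F1 (h • j) a'))),
       exists (a : hom (F0 (h • j) a0) (F0 (h • j) a1)) (alpha : cell a (F1 (h • j) a')),
       existT (fun x => cell x (F1 i (F1 (h • j) a'))) (F1 i a) (F2 i alpha)
       = existT (fun x => cell x _) b beta by rewrite Eid.
    move=> a0 a1 a' b beta; case: (fib1 _ _ (F1 j a') b beta) => e [al Eal].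
    by exists (F1 h e), (F2 h al).
Qed.

Lemma tfib_retract (h : Morph E A) : h • j = idM A -> i • h = p -> tfib p -> tfib i.
Proof.
  move=> Eid <- [/= surj0 [surj1 [fu fa]]]; split; [|split; [|split]].
  - by move=> b; case: (surj0 b) => e <-; exists (F0 h e).
  - suff: forall (x x' : ob A) (g : hom (F0 i (F0 (h • j) x)) (F0 i (F0 (h • j) x'))),
      exists f, F1 i f = g by rewrite Eid.
    by move=> x x' g; case: (surj1 _ _ g) => f <-; exists (F1 h f).
  - suff: forall (x x' : ob A) (f g : hom x x') (y : cell (F1 i (F1 (h • j) f)) (F1 i (F1 (h • j) g))),
      exists z, F2 i z = y by rewrite Eid.
    by move=> x x' f g y; case: (fu _ _ _ _ y) => z <-; exists (F2 h z).
  - suff: forall (x x' : ob A) (f g : hom x x') (y z : cell f g),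
      F2 i (F2 (h • j) y) = F2 i (F2 (h • j) z) -> F2 (h • j) y = F2 (h • j) z by rewrite Eid.
    by move=> x x' f g y z E0; rewrite /=; congr (F2 h _); apply: fa.
Qed.

End Retracts.

(** The converse inclusions are the retract argument: a lift of a map against a factor of its own
    factorization through [cyl] exhibits it as a retract of the other factor. *)
Lemma cofibration_tfib_WFS :
  is_WFS Bigpd cofibration (cap_class Bigpd fibration weak_equivalence).
Proof.
  split; [|split].
  - move=> X Y F; exists (cyl F), (cyl_in F), (cyl_out F); split; [|split].
    + exact: cyl_in_cofibration.
    + apply/tfib_iff; exact: cyl_out_tfib.
    + exact: cyl_factor.
  - move=> A B i; split.
    + by move=> ci X Y p /tfib_iff tp u v; apply: tfib_lift.
    + move=> H; case: (H _ _ (cyl_out i) _ (cyl_in i) (idM B)).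
      * by apply/tfib_iff; exact: cyl_out_tfib.
      * by rewrite /= cyl_factor compM_idl.
      * by move=> h [/cofibration_retract Eh _]; apply: Eh; exact: cyl_in_cofibration.
  - move=> X Y p; split.
    + by move=> /tfib_iff tp A B i ci u v; apply: tfib_lift.
    + move=> H; case: (H _ _ (cyl_in p) (@cyl_in_cofibration _ _ p) (idM X) (cyl_out p)).
      * by rewrite /= cyl_factor compM_idr.
      * move=> h [Eid Ep]; apply/tfib_iff; apply: (tfib_retract Eid Ep); exact: cyl_out_tfib.
Qed.

(** * The mapping path bigroupoid *)

(** This and [paste_prer] pull out of a pasting the constraints [vinv (phc F _ _)] that occur in
    [mp_comp]. *)
Lemma paste_prel (B : Bigroupoid) (u1 u2 u3 v1 v2 v3 : ob B) (h1 : hom u1 u2) (h2 h2' : hom u2 u3)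
    (g1 : hom v1 v2) (g2 : hom v2 v3) (e1 : hom v1 u1) (e2 : hom v2 u2) (e3 : hom v3 u3)
    (t2 : cell (h2' ⊙ e2) (e3 ⊙ g2)) (t1 : cell (h1 ⊙ e1) (e2 ⊙ g1)) (x : cell h2 h2') :
  paste (t2 ∘ (x ▷ e2)) t1 = paste t2 t1 ∘ ((x ▷ h1) ▷ e1).
Proof.
  rewrite /paste -!lock rwM !vcA ascl (pre2 (eq_sym (exch x t1))) vcA.
  by rewrite (pre2 (vconj (ascl _ _ x))) vcA.
Qed.

Lemma paste_prer (B : Bigroupoid) (u1 u2 u3 v1 v2 v3 : ob B) (h1 h1' : hom u1 u2) (h2 : hom u2 u3)
    (g1 : hom v1 v2) (g2 : hom v2 v3) (e1 : hom v1 u1) (e2 : hom v2 u2) (e3 : hom v3 u3)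
    (t2 : cell (h2 ⊙ e2) (e3 ⊙ g2)) (t1 : cell (h1' ⊙ e1) (e2 ⊙ g1)) (x : cell h1 h1') :
  paste t2 (t1 ∘ (x ▷ e1)) = paste t2 t1 ∘ ((h2 ◁ x) ▷ e1).
Proof. by rewrite /paste -!lock lwM !vcA ascm. Qed.

Section MappingPath.
Context (A B : Bigroupoid) (F : Morph A B).

Record mp_ob : Type := MpOb { mpa : ob A; mpb : ob B; mpe : hom mpb (F0 F mpa) }.

Record mp_hom (x y : mp_ob) : Type := MpHom {
  mpk : hom (mpa x) (mpa y);
  mpg : hom (mpb x) (mpb y);
  mps : cell (F1 F mpk ⊙ mpe x) (mpe y ⊙ mpg)
}.

(** A square over any [k], its lower side obtained by conjugating [F1 F k] with the edges.
    Identities and inverses of [mp] are such fillers, so [mp_src] preserves them up to the 2-cells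
    supplied by [complete]. *)
Definition mp_fill (x y : mp_ob) (k : hom (mpa x) (mpa y)) : mp_hom x y :=
  {| mpk := k; mpg := inv1 (mpe y) ⊙ (F1 F k ⊙ mpe x); mps := vinv (linv_cell (mpe y) _) |}.

Definition mp_comp (x y z : mp_ob) (q : mp_hom y z) (r : mp_hom x y) : mp_hom x z :=
  {| mpk := mpk q ⊙ mpk r; mpg := mpg q ⊙ mpg r;
     mps := paste (mps q) (mps r) ∘ (vinv (phc F (mpk q) (mpk r)) ▷ mpe x) |}.

(* A 2-cell of the mapping path space is a compatible pair of 2-cells of [A] and [B];
   the second one is determined by the first, so it is left out. *)
Definition mp_data : BGData := {|
  ob := mp_ob;
  hom := mp_hom;
  cell := fun x y q r => cell (mpk q) (mpk r);
  vc := fun x y f g h c d => c ∘ d;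
  idc := fun x y f => idc (mpk f);
  vinv := fun x y f g c => vinv c;
  c1 := mp_comp;
  hc := fun x y z g g' f f' c d => c ⋆ d;
  i1 := fun x => @mp_fill x x (i1 (mpa x));
  inv1 := fun x y f => @mp_fill y x (inv1 (mpk f));
  inv2 := fun x y f g c => inv2 c;
  asc := fun x y z w h g f => asc (mpk h) (mpk g) (mpk f);
  lu := fun x y f => lu (mpk f);
  ru := fun x y f => ru (mpk f);
  ev := fun x y f => ev (mpk f);
  coev := fun x y f => coev (mpk f)
|}.

Lemma mp_laws : BGLaws mp_data.
Proof. by case: (bg_laws A) => *; split=> /=; intros; auto. Qed.

Definition mp : Bigroupoid := {| bg_data := mp_data; bg_laws := mp_laws |}.

Definition mp_tgt : Morph mp A.
Proof.
apply: complete; refine (@Build_Semi mp A mpa mpk (fun x y g f c => c)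
  (fun x y z g f => idc _) _ _ _) => /=.
- by [].
- by move=> *; rewrite vc1l vc1r.
- by move=> *; rewrite !hc11 !vc1l !vc1r.
Defined.

Lemma mp_tgt_faithful (x x' : ob mp) : faithful_at mp_tgt x x'.
Proof. by move=> f g c d E; exact: E. Qed.

Lemma mp_tgt_bieq : bieq mp_tgt.
Proof.
  split=> [a|x x'].
  - by exists (MpOb (i1 (F0 F a))); constructor; exact: i1.
  - split; [|split].
    + by move=> k; exists (@mp_fill x x' k); constructor; exact: idc.
    + by move=> f g c; exists c.
    + exact: mp_tgt_faithful.
Qed.

(** The component in [B] of a 2-cell, recovered from compatibility with the two squares. *)
Definition mp_src2 (x y : mp_ob) (q r : mp_hom x y) (c : cell (mpk q) (mpk r)) :
    cell (mpg q) (mpg r) :=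
  lfill (mps r ∘ ((F2 F c ▷ mpe x) ∘ vinv (mps q))).

Lemma mp_src2P (x y : mp_ob) (q r : mp_hom x y) (c : cell (mpk q) (mpk r)) :
  mps r ∘ (F2 F c ▷ mpe x) = (mpe y ◁ mp_src2 c) ∘ mps q.
Proof. by rewrite lfillK !vcA vcVl vc1r. Qed.

(** Reduces every computation of a component in [B] to a compatibility of squares. *)
Lemma mp_src2_uniq (x y : mp_ob) (q r : mp_hom x y) (c : cell (mpk q) (mpk r))
    (d : cell (mpg q) (mpg r)) :
  mps r ∘ (F2 F c ▷ mpe x) = (mpe y ◁ d) ∘ mps q -> mp_src2 c = d.
Proof.
  by rewrite mp_src2P => E; apply: (lw_inj (f := mpe y)); apply: vc_canr E.
Qed.

Lemma mp_src2_vc (x y : mp_ob) (f g h : mp_hom x y) (c : cell (mpk g) (mpk h))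
    (d : cell (mpk f) (mpk g)) :
  mp_src2 (c ∘ d : cell (mpk f) (mpk h)) = mp_src2 c ∘ mp_src2 d.
Proof.
  apply: mp_src2_uniq; rewrite F2M rwM lwM -vcA mp_src2P vcA mp_src2P.
  by rewrite vcA.
Qed.

Lemma mp_src2_hc (x y z : mp_ob) (g g' : mp_hom y z) (f f' : mp_hom x y)
    (c : cell (mpk g) (mpk g')) (d : cell (mpk f) (mpk f')) :
  @mp_src2 _ _ (mp_comp g f) (mp_comp g' f') (c ⋆ d) = mp_src2 c ⋆ mp_src2 d.
Proof.
  apply: mp_src2_uniq => /=.
  rewrite vcA -rwM (vconj (eq_sym (phcN F c d))) rwM.
  by rewrite (pre2 (paste_nat (mp_src2P c) (mp_src2P d))) vcA.
Qed.

Lemma mp_src2_asc (x y z w : mp_ob) (h : mp_hom z w) (g : mp_hom y z) (f : mp_hom x y) :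
  @mp_src2 _ _ (mp_comp (mp_comp h g) f) (mp_comp h (mp_comp g f)) (asc (mpk h) (mpk g) (mpk f))
  = asc (mpg h) (mpg g) (mpg f).
Proof.
  apply: mp_src2_uniq => /=.
  rewrite paste_prer paste_prel !vcA -!rwM lwV rwV.
  rewrite (pre2 (eq_sym (paste_asc _ _ _))) vcA -rwM; congr (_ ∘ (_ ▷ _)).
  apply: (vc_canl (x := F1 F (mpk h) ◁ phc F (mpk g) (mpk f))); rewrite vcKr.
  apply: (vc_canl (x := phc F (mpk h) (mpk g ⊙ mpk f))); rewrite vcKr.
  by rewrite (pre3 (eq_sym (phcA F _ _ _))) !vcA vcKr vcVr vc1r.
Qed.

Definition mp_src : Morph mp B.
Proof.
apply: complete; refine (@Build_Semi mp B mpb mpg mp_src2 (fun x y z g f => idc _) _ _ _) => /=.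
- exact: mp_src2_vc.
- by move=> *; rewrite vc1l vc1r; exact: mp_src2_hc.
- by move=> *; rewrite !hc11 !vc1l !vc1r; exact: mp_src2_asc.
Defined.

Lemma mp_src_fibration : fibration mp B mp_src.
Proof.
  split=> /=.
  - move=> x b g; exists (MpOb (mpe x ⊙ g)).
    (* The lift is the identity in [A]; its square is the left unitor at [mpe x ⊙ g], corrected by
       the unit constraint of [F]. *)
    by exists (@MpHom (MpOb (mpe x ⊙ g)) x (i1 (mpa x)) g
      (lu (mpe x ⊙ g) ∘ (vinv (ph1 F (mpa x)) ▷ (mpe x ⊙ g)))).
  - move=> x y r b c.
    (* The component in [A] stays fixed, and the change of lower side is absorbed by the square. *)
    exists (@MpHom x y (mpk r) b (vinv (mpe y ◁ c) ∘ mps r)), (idc (mpk r)).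
    congr existT; apply: mp_src2_uniq => /=.
    by rewrite F2_1 hc11 vc1r vcKr.
Qed.

(** The edge is [F1 F (i1 a)] and not [i1 (F0 F a)]: this choice is preserved strictly by
    composition with a further morphism, as [mp_post_unit] requires. *)
Definition mp_unit0 (a : ob A) : mp_ob := MpOb (F1 F (i1 a)).

Definition mp_unit1 (a a' : ob A) (k : hom a a') : mp_hom (mp_unit0 a) (mp_unit0 a') :=
  @MpHom (mp_unit0 a) (mp_unit0 a') k (F1 F k) (Fsquare F (ucell k)).

Definition mp_unit : Morph A mp.
Proof.
apply: complete; refine (@Build_Semi A mp mp_unit0 mp_unit1 (fun x y g f c => c)
  (fun x y z g f => idc (g ⊙ f)) _ _ _) => /=.
- by [].
- by move=> *; rewrite vc1l vc1r.
- by move=> *; rewrite !hc11 !vc1l !vc1r.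
Defined.

Lemma mp_unit_cofibration : cofibration A mp mp_unit.
Proof.
  split=> [a a' E|a a' k k' E]; first exact: (f_equal mpa E).
  exact: (f_equal (@mpk _ _) E).
Qed.

Lemma mp_tgt_unit : mp_tgt • mp_unit = idM A.
Proof. by apply: morph_eq => //= *; rewrite vc1r. Qed.

Lemma mp_unit_bieq : bieq mp_unit.
Proof.
  by apply: (bieq_cancell mp_tgt_bieq); rewrite mp_tgt_unit; exact: bieq_id.
Qed.

Lemma mp_src_unit : mp_src • mp_unit = F.
Proof.
  apply: morph_eq => //=.
  - move=> a a' k k' c; congr pk2.
    apply: (@mp_src2_uniq _ _ (mp_unit1 k) (mp_unit1 k')) => /=.
    exact: Fsquare_nat (ucell_nat c).
  - move=> a b c g f; congr pk2; rewrite vc1r.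
    apply: (@mp_src2_uniq _ _ (mp_comp (mp_unit1 g) (mp_unit1 f)) (mp_unit1 (g ⊙ f))) => /=.
    rewrite F2_1 hc11 vc1r -vcA paste_Fsquare paste_ucell vcA -rwM vcVr hc11 vc1r.
    by [].
Qed.

End MappingPath.

Lemma Fsquare_pre (A B : Bigroupoid) (F : Morph A B) (u1 u2 v1 v2 : ob A) (h h' : hom u1 u2)
    (g : hom v1 v2) (e1 : hom v1 u1) (e2 : hom v2 u2) (t : cell (h' ⊙ e1) (e2 ⊙ g)) (x : cell h h') :
  Fsquare F (t ∘ (x ▷ e1)) = Fsquare F t ∘ (F2 F x ▷ F1 F e1).
Proof. by rewrite /Fsquare F2M !vcA phcNl. Qed.

Lemma Fsquare_comp (A B C : Bigroupoid) (F : Morph A B) (G : Morph B C) (u1 u2 v1 v2 : ob A)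
    (h : hom u1 u2) (g : hom v1 v2) (e1 : hom v1 u1) (e2 : hom v2 u2)
    (t : cell (h ⊙ e1) (e2 ⊙ g)) :
  Fsquare (G • F) t = Fsquare G (Fsquare F t).
Proof. by rewrite /Fsquare /= vinv_vc !F2M F2V !vcA. Qed.

(** * Functoriality of the mapping path bigroupoid under postcomposition *)

Section Postcomposition.
Context (A B C : Bigroupoid) (F : Morph A B) (G : Morph B C).

Definition mp_post0 (x : mp_ob F) : mp_ob (G • F) := @MpOb _ _ (G • F) (mpa x) _ (F1 G (mpe x)).

Definition mp_post1 (x y : mp_ob F) (q : mp_hom x y) : mp_hom (mp_post0 x) (mp_post0 y) :=
  @MpHom _ _ (G • F) (mp_post0 x) (mp_post0 y) (mpk q) (F1 G (mpg q)) (Fsquare G (mps q)).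

Definition mp_post : Morph (mp F) (mp (G • F)).
Proof.
apply: complete; refine (@Build_Semi (mp F) (mp (G • F)) mp_post0 mp_post1 (fun x y g f c => c)
  (fun x y z g f => idc (mpk g ⊙ mpk f)) _ _ _) => /=.
- by [].
- by move=> *; rewrite (@vc1l A) (@vc1r A).
- by move=> *; rewrite !(@hc11 A) !(@vc1l A) !(@vc1r A).
Defined.

Lemma mp_src_post_phc (x y z : mp_ob F) (q : mp_hom y z) (r : mp_hom x y) :
  @mp_src2 _ _ _ _ _ (mp_comp (mp_post1 q) (mp_post1 r)) (mp_post1 (mp_comp q r))
    (idc (mpk q ⊙ mpk r)) = phc G (mpg q) (mpg r).
Proof.
  apply: mp_src2_uniq => /=.
  rewrite !F2_1 hc11 vc1r Fsquare_pre -vcA paste_Fsquare vcA -rwM.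
  by rewrite vinv_vc F2V vcKr.
Qed.

Lemma mp_src_post : mp_src (G • F) • mp_post = G • mp_src F.
Proof.
  apply: morph_eq; [by []|by []| |].
  - move=> x y q r c; apply: (f_equal (@pk2 C _ _ _ _)).
    apply: (@mp_src2_uniq _ _ _ _ _ (mp_post1 q) (mp_post1 r)).
    exact: Fsquare_nat (mp_src2P c).
  - move=> x y z q r; apply: (f_equal (@pk2 C _ _ _ _)).
    change (@mp_src2 _ _ _ _ _ (mp_comp (mp_post1 q) (mp_post1 r)) (mp_post1 (mp_comp q r))
        (idc (mpk q ⊙ mpk r)) ∘ idc (F1 G (mpg q) ⊙ F1 G (mpg r))
      = F2 G (idc (mpg q ⊙ mpg r)) ∘ phc G (mpg q) (mpg r)).
    by rewrite mp_src_post_phc vc1r F2_1 vc1l.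
Qed.

Lemma mp_tgt_post : mp_tgt (G • F) • mp_post = mp_tgt F.
Proof.
  apply: morph_eq => [x|x y q|x y q r c|x y z q r].
  - by [].
  - by change (pk1 (mpk q) = pk1 (mpk q)).
  - by change (@pk2 A _ _ (mpk q) (mpk r) c = @pk2 A _ _ (mpk q) (mpk r) c).
  - change (pk2 (idc (mpk q ⊙ mpk r) ∘ idc (mpk q ⊙ mpk r)) = pk2 (idc (mpk q ⊙ mpk r))).
    by rewrite vc1r.
Qed.

(** On 0-cells both sides agree by computation, on 1-cells by [Fsquare_comp]; the faithful [mp_tgt]
    settles the rest. *)
Lemma mp_post_unit : mp_post • mp_unit F = mp_unit (G • F).
Proof.
  apply: (morph_eq_faithful (@mp_tgt_faithful _ _ (G • F))); [by []| |].
  - move=> a a' k.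
    apply: (f_equal (@pk1 (mp (G • F)) (mp_unit0 (G • F) a) (mp_unit0 (G • F) a'))).
    exact: (f_equal (@MpHom _ _ (G • F) (mp_unit0 (G • F) a) (mp_unit0 (G • F) a') k (F1 G (F1 F k)))
      (eq_sym (Fsquare_comp F G (ucell k)))).
  - by rewrite -compM_assoc mp_tgt_post !mp_tgt_unit.
Qed.

Context (fib_G : fibration B C G).

(** The first fibration property lifts edges into [F0 G (F0 F a)]. A square over [k] is compared
    with the image of the filler of [k], and the second property lifts the comparison. The 2-cells
    are the same on both sides. *)
Lemma mp_post_tfib : tfib mp_post.
Proof.
  case: fib_G => fib0 fib1; split; [|split; [|split]].
  - move=> [a c e]; case: (fib0 _ _ e) => b [e' E].
    exists (MpOb e').
    exact: (f_equal (fun t : {c : ob C & hom c (F0 G (F0 F a))} => @MpOb _ _ (G • F) a _ (projT2 t)) E).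
  - move=> x y [/= k g s].
    pose m := mp_fill (x := x) (y := y) k.
    case: (fib1 _ _ (mpg m) g (lfill (Fsquare G (mps m) ∘ vinv s))) => g' [d E].
    exists (@MpHom _ _ F x y k g' (vinv (mpe y ◁ d) ∘ mps m)).
    have Es : (F1 G (mpe y) ◁ lfill (Fsquare G (mps m) ∘ vinv s)) ∘ s = Fsquare G (mps m).
    { by rewrite lfillK vcA vcVl vc1r. }
    (* The lift comes with an equality of dependent pairs; stating the claim for an arbitrary pair
       [t] allows that equality to be eliminated. *)
    have key : forall t : {g : hom (F0 G (mpb x)) (F0 G (mpb y)) & cell g (F1 G (mpg m))},
      existT _ (F1 G g') (F2 G d) = t ->
      forall s : cell (F1 G (F1 F k) ⊙ F1 G (mpe x)) (F1 G (mpe y) ⊙ projT1 t),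
      (F1 G (mpe y) ◁ projT2 t) ∘ s = Fsquare G (mps m) ->
      mp_post1 (@MpHom _ _ F x y k g' (vinv (mpe y ◁ d) ∘ mps m))
      = @MpHom _ _ (G • F) (mp_post0 x) (mp_post0 y) k (projT1 t) s.
    { move=> _ <- /= s' Es'; rewrite /mp_post1 /=; congr MpHom.
      apply: (vc_canl (x := F1 G (mpe y) ◁ F2 G d)); rewrite Es'.
      rewrite -(@Fsquare_nat _ _ G _ _ _ _ _ _ _ _ _ _ _ (mps m) (idc _)).
      - by rewrite hc11 vc1r vcKr.
      - by rewrite F2_1 hc11 vc1r. }
    move: Es E; set d' := lfill _; move: d' => d' Es /key E; exact: (E s).
  - by move=> x y q r c; exists c.
  - by move=> x y q r c d E; exact: E.
Qed.

End Postcomposition.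

(** * Contraction of the mapping path bigroupoid *)

Section Contraction.
Context (A B : Bigroupoid) (F : Morph A B).

(** By the choice of edge in [mp_unit0], both composites around this square are
    [F1 F (i1 (mpa x)) ⊙ mpe x], so an identity fills it. *)
Definition mp_edge (x : mp_ob F) : mp_hom x (mp_unit0 F (mpa x)) :=
  @MpHom _ _ F x (mp_unit0 F (mpa x)) (i1 (mpa x)) (mpe x) (idc _).

Definition mp_contr0 (x : mp_ob F) : mp_ob (mp_unit F) := @MpOb _ _ (mp_unit F) (mpa x) x (mp_edge x).

(** Squares in [mp F] are 2-cells of [A], and the edges lie over identities, hence [ucell] fits. *)
Definition mp_contr1 (x y : mp_ob F) (q : mp_hom x y) : mp_hom (mp_contr0 x) (mp_contr0 y) :=
  @MpHom _ _ (mp_unit F) (mp_contr0 x) (mp_contr0 y) (mpk q) q (ucell (mpk q)).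

Definition mp_contr : Morph (mp F) (mp (mp_unit F)).
Proof.
apply: complete; refine (@Build_Semi (mp F) (mp (mp_unit F)) mp_contr0 mp_contr1 (fun x y g f c => c)
  (fun x y z g f => idc (mpk g ⊙ mpk f)) _ _ _) => /=.
- by [].
- by move=> *; rewrite (@vc1l A) (@vc1r A).
- by move=> *; rewrite !(@hc11 A) !(@vc1l A) !(@vc1r A).
Defined.

Lemma mp_src_contr_phc (x y z : mp_ob F) (q : mp_hom y z) (r : mp_hom x y) :
  @mp_src2 _ _ _ _ _ (mp_comp (mp_contr1 q) (mp_contr1 r)) (mp_contr1 (mp_comp q r))
    (idc (mpk q ⊙ mpk r)) = idc (mpk q ⊙ mpk r).
Proof.
  apply: (@mp_src2_uniq _ _ _ _ _ (mp_comp (mp_contr1 q) (mp_contr1 r)) (mp_contr1 (mp_comp q r))).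
  (* Pasting in [mp F] computes to pasting in [A], so [paste_ucell] applies there. *)
  have -> : mps (mp_comp (mp_contr1 q) (mp_contr1 r)) =
      ucell (mpk q ⊙ mpk r) ∘ (vinv (idc (mpk q ⊙ mpk r)) ▷ i1 (mpa x)).
  { by rewrite -paste_ucell. }
  change (ucell (mpk q ⊙ mpk r) ∘ (idc (mpk q ⊙ mpk r) ▷ i1 (mpa x)) =
    (i1 (mpa z) ◁ idc (mpk q ⊙ mpk r))
    ∘ (ucell (mpk q ⊙ mpk r) ∘ (vinv (idc (mpk q ⊙ mpk r)) ▷ i1 (mpa x)))).
  by rewrite ucell_nat rwV !hc11 vinv1 vc1r.
Qed.

Lemma mp_src_contr : mp_src (mp_unit F) • mp_contr = idM (mp F).
Proof.
  apply: morph_eq; [by []|by []| |].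
  - move=> x y q r c; apply: (f_equal (@pk2 (mp F) x y q r)).
    apply: (@mp_src2_uniq _ _ _ _ _ (mp_contr1 q) (mp_contr1 r)).
    exact: (@ucell_nat A).
  - move=> x y z q r; apply: (f_equal (@pk2 (mp F) x z (mp_comp q r) (mp_comp q r))).
    change ((@mp_src2 _ _ _ _ _ (mp_comp (mp_contr1 q) (mp_contr1 r)) (mp_contr1 (mp_comp q r))
        (idc (mpk q ⊙ mpk r)) : cell (mpk q ⊙ mpk r) (mpk q ⊙ mpk r)) ∘ idc (mpk q ⊙ mpk r)
      = idc (mpk q ⊙ mpk r)).
    by rewrite vc1r; exact: mp_src_contr_phc.
Qed.

Lemma mp_tgt_contr : mp_tgt (mp_unit F) • mp_contr = mp_tgt F.
Proof.
  apply: morph_eq => [x|x y q|x y q r c|x y z q r].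
  - by [].
  - by change (pk1 (mpk q) = pk1 (mpk q)).
  - by change (@pk2 A _ _ (mpk q) (mpk r) c = @pk2 A _ _ (mpk q) (mpk r) c).
  - change (pk2 (idc (mpk q ⊙ mpk r) ∘ idc (mpk q ⊙ mpk r)) = pk2 (idc (mpk q ⊙ mpk r))).
    by rewrite vc1r.
Qed.

(* Both [mp_contr] and [mp_unit (mp_unit F)] take the unit of [a] to an object of this form. *)
Definition mp_loop (a : ob A) (t : cell (F1 F (i1 a) ⊙ F1 F (i1 a)) (F1 F (i1 a) ⊙ F1 F (i1 a))) :
    mp_ob (mp_unit F) :=
  @MpOb _ _ (mp_unit F) a (mp_unit0 F a)
    (@MpHom _ _ F (mp_unit0 F a) (mp_unit0 F a) (i1 a) (F1 F (i1 a)) t).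

Definition mp_loop_hom (a a' : ob A) (k : hom a a') t t' (s : cell (k ⊙ i1 a) (i1 a' ⊙ k)) :
    @hom (mp (mp_unit F)) (@mp_loop a t) (@mp_loop a' t') :=
  @MpHom _ _ (mp_unit F) (@mp_loop a t) (@mp_loop a' t') k (mp_unit1 F k) s.

(** Since [lu] and [ru] agree at [i1 a], its [ucell] is an identity. Hence the edge used by
    [mp_unit (mp_unit F)] at [a] equals [mp_edge], which gives [mp_contr_unit]. *)
Lemma Fsquare_ucell_i1 (a : ob A) : Fsquare F (ucell (i1 a)) = idc _.
Proof. by rewrite /Fsquare /ucell lu_ru_i1 vcVl F2_1 vc1l vcVl. Qed.

Lemma mps_mp_unit1 (a a' : ob A) (k : hom a a') :
  (mps (mp_unit1 (mp_unit F) k) : cell (k ⊙ i1 a) (i1 a' ⊙ k)) = ucell k.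
Proof.
  change (vinv (idc (i1 a' ⊙ k)) ∘ (ucell k ∘ idc (k ⊙ i1 a)) = ucell k).
  by rewrite vinv1 vc1l vc1r.
Qed.

Lemma mp_contr_unit : mp_contr • mp_unit F = mp_unit (mp_unit F).
Proof.
  apply: (morph_eq_faithful (@mp_tgt_faithful _ _ (mp_unit F))).
  - move=> a; change (mp_loop (idc (F1 F (i1 a) ⊙ F1 F (i1 a))) = mp_loop (Fsquare F (ucell (i1 a)))).
    by rewrite Fsquare_ucell_i1.
  - move=> a a' k.
    change (pk1 (@mp_loop_hom a a' k (idc (F1 F (i1 a) ⊙ F1 F (i1 a)))
        (idc (F1 F (i1 a') ⊙ F1 F (i1 a'))) (ucell k)) =
      pk1 (@mp_loop_hom a a' k (Fsquare F (ucell (i1 a))) (Fsquare F (ucell (i1 a')))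
        (mps (mp_unit1 (mp_unit F) k)))).
    by rewrite !Fsquare_ucell_i1 mps_mp_unit1.
  - by rewrite -compM_assoc mp_tgt_contr !mp_tgt_unit.
Qed.

End Contraction.

(** * Lifting trivial cofibrations against fibrations *)

Lemma mp_unit_lift (A B X Y : Bigroupoid) (F : Morph A B) (p : Morph X Y) (u : Morph A X)
    (v : Morph (mp F) Y) :
  fibration X Y p -> p • u = v • mp_unit F ->
  exists h : Morph (mp F) X, h • mp_unit F = u /\ p • h = v.
Proof.
  move=> fib_p E.
  (* [W] pushes the contraction of [mp F] forward along [v]; it is stated existentially so that [E]
     can be rewritten inside its type. *)
  have [W [W_unit W_src]] : exists W : Morph (mp F) (mp (p • u)),
      W • mp_unit F = mp_unit (p • u) /\ mp_src (p • u) • W = v.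
  { rewrite E; exists (mp_post (mp_unit F) v • mp_contr F); split.
    - by rewrite compM_assoc mp_contr_unit mp_post_unit.
    - by rewrite -compM_assoc mp_src_post compM_assoc mp_src_contr compM_idr. }
  have sq : mp_post u p • mp_unit u = W • mp_unit F by rewrite mp_post_unit W_unit.
  case: (tfib_lift (@mp_unit_cofibration _ _ F) (mp_post_tfib u fib_p) sq) => l [l_unit l_post].
  (* Taking sources turns the lift into [mp u] into a lift into [X], because [mp_src] commutes with
     [mp_post]. *)
  exists (mp_src u • l); split.
  - by rewrite compM_assoc l_unit mp_src_unit.
  - by rewrite -compM_assoc -mp_src_post compM_assoc l_post.
Qed.

(** By cancellation [mp_src i] is a trivial fibration; lifting [i] against it presents [i] as a
    retract of [mp_unit i], which lifts by [mp_unit_lift]. *)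
Lemma trivial_cofibration_lift (A B X Y : Bigroupoid) (i : Morph A B) (p : Morph X Y)
    (u : Morph A X) (v : Morph B Y) :
  cofibration A B i -> weak_equivalence A B i -> fibration X Y p -> p • u = v • i ->
  exists h : Morph B X, h • i = u /\ p • h = v.
Proof.
  move=> cof_i /weak_equivalence_iff be_i fib_p E.
  have tf_src : tfib (mp_src i).
  { apply/tfib_iff; split; first exact: mp_src_fibration.
    apply/weak_equivalence_iff; apply: (bieq_cancelr (mp_unit_bieq i)).
    by rewrite mp_src_unit. }
  have sq : mp_src i • mp_unit i = idM B • i by rewrite mp_src_unit compM_idl.
  case: (tfib_lift cof_i tf_src sq) => h [h_i h_src].
  have sq' : p • u = (v • mp_src i) • mp_unit i by rewrite compM_assoc mp_src_unit.
  case: (mp_unit_lift fib_p sq') => m [m_unit m_p].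
  exists (m • h); split.
  - by rewrite compM_assoc h_i.
  - by rewrite -compM_assoc m_p compM_assoc h_src compM_idr.
Qed.

Lemma trivial_cofibration_fibration_WFS :
  is_WFS Bigpd (cap_class Bigpd cofibration weak_equivalence) fibration.
Proof.
  have unit_cof X Y (F : Morph X Y) : cap_class Bigpd cofibration weak_equivalence _ _ (mp_unit F).
  { split; first exact: mp_unit_cofibration.
    by apply/weak_equivalence_iff; exact: mp_unit_bieq. }
  split; [|split].
  - move=> X Y F; exists (mp F), (mp_unit F), (mp_src F); split; [|split].
    + exact: unit_cof.
    + exact: mp_src_fibration.
    + exact: mp_src_unit.
  - move=> A B i; split.
    + by move=> [ci wi] X Y p fp u v; apply: trivial_cofibration_lift.
    + move=> H; case: (H _ _ (mp_src i) (@mp_src_fibration _ _ i) (mp_unit i) (idM B)).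
      * by rewrite /= mp_src_unit compM_idl.
      * move=> h [/= Ei Eid]; split.
        -- exact: cofibration_retract Ei (proj1 (unit_cof _ _ _)).
        -- by apply/weak_equivalence_iff; apply: (bieq_retract Ei Eid); exact: mp_unit_bieq.
  - move=> X Y p; split.
    + by move=> fp A B i [ci wi] u v; apply: trivial_cofibration_lift.
    + move=> H; case: (H _ _ (mp_unit p) (unit_cof _ _ p) (idM X) (mp_src p)).
      * by rewrite /= mp_src_unit compM_idr.
      * by move=> h [Eid Ep]; apply: (fibration_retract Eid Ep); exact: mp_src_fibration.
Qed.

Theorem mainTheorem1 :
  is_model_structure Bigpd fibration cofibration weak_equivalence.
Proof.
  split; [|split; [|split]].
  - exact: iso_weak_equivalence.
  - exact: two_out_of_three_weak_equivalence.
  - exact: cofibration_tfib_WFS.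
  - exact: trivial_cofibration_fibration_WFS.
Qed.
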